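(* Let $\mathfrak{g}$ be a finite dimensional simple complex Lie algebra. Suppose $a(u)=1$ and let $\alpha$ be a simple root and $k$ its coefficient in the decomposition of the maximal root $\alpha_{\max}$ as a combination of simple roots. (i) If $k=1$, there exists a one-to-one correspondence between Lagrangian subalgebras $W$ of $\mathfrak{g}((u))\oplus\mathfrak{g}[\varepsilon]$, with respect to $Q_{a(u)}$, which are transversal to $\mathfrak{g}[[u]]$ and satisfy $W\subseteq (\mathbb{O}_{\alpha}\cap\mathfrak{g}[u,u^{-1}])\oplus\mathfrak{g}[\varepsilon]$, and Lagrangian subalgebras in $\mathfrak{g}[\varepsilon]$, with respect to $\bar{Q}_{\varepsilon}$, transversal to $P_{\alpha}^{-}+\varepsilon (P_{\alpha}^{-})^{\perp}$. (ii) If $k>1$, there are no Lagrangian subalgebras $W$ of $\mathfrak{g}((u))\oplus\mathfrak{g}[\varepsilon]$, with respect to $Q_{a(u)}$, which are transversal to $\mathfrak{g}[[u]]$ and satisfy $W\subseteq (\mathbb{O}_{\alpha}\cap\mathfrak{g}[u,u^{-1}])\oplus\mathfrak{g}[\varepsilon]$.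
   Context: $\mathfrak{g}$ has a fixed Cartan subalgebra $\mathfrak{h}$, root system $R$, set of simple roots $\Gamma=\{\alpha_i\}$, root spaces $\mathfrak{g}_\beta$, and maximal root $\alpha_{\max}=\sum_j k_j\alpha_j$. A root ''contains'' $\alpha$ if its coefficient at $\alpha$ in the expansion in simple roots is non-zero. $K$ denotes the Killing form of $\mathfrak{g}$, and also its $\mathbb{C}((u))$-bilinear extension to $\mathfrak{g}((u))$. $\mathfrak{g}[\varepsilon]=\mathfrak{g}+\varepsilon\mathfrak{g}$ with $\varepsilon^2=0$, equipped with the form $\bar{Q}_{\varepsilon}(x_1+\varepsilon x_2,y_1+\varepsilon y_2)=K(x_1,y_2)+K(x_2,y_1)$. The form on $\mathfrak{g}((u))\oplus\mathfrak{g}[\varepsilon]$: $Q_{a(u)}(f_1+x_2+\varepsilon x_3,\,f_2+y_2+\varepsilon y_3)=\mathrm{Res}_{u=0}(u^{-2}a(u)K(f_1(u),f_2(u)))-K(x_3,y_2)-K(x_2,y_3)$ for $f_1,f_2\in\mathfrak{g}((u))$, $x_2,x_3,y_2,y_3\in\mathfrak{g}$. The algebra $\mathfrak{g}[[u]]$ is embedded in $\mathfrak{g}((u))\oplus\mathfrak{g}[\varepsilon]$ by $f(u)=\sum_{n\ge0}f_nu^n\mapsto (f(u),\,f_0+\varepsilon f_1)$. The maximal order $\mathbb{O}_\alpha$: let $\mathfrak{h}(\mathbb{R})=\{h\in\mathfrak{h}:\beta(h)\in\mathbb{R}\ \forall\beta\in R\}$, and let $v$ be the valuation on $\mathbb{C}((u^{-1}))$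 with $v(\sum_{m\ge n}a_mu^{-m})=n$ when $a_n\ne0$ (and $v(0)=+\infty$). For $h\in\mathfrak{h}(\mathbb{R})$ and $\beta\in R$ put $M_\beta(h)=\{f\in\mathbb{C}((u^{-1})):v(f)\ge\beta(h)\}$ and $\mathbb{O}_h=\mathfrak{h}[[u^{-1}]]\oplus\bigoplus_{\beta\in R}M_\beta(h)\otimes\mathfrak{g}_\beta$. For $\alpha=\alpha_j$ set $\mathbb{O}_\alpha=\mathbb{O}_{h_j}$, where $h_j\in\mathfrak{h}(\mathbb{R})$ is defined by $\alpha_i(h_j)=\delta_{ij}/k_j$ for all $i$. The intersection $\mathbb{O}_\alpha\cap\mathfrak{g}[u,u^{-1}]$ is taken in $\mathfrak{g}((u^{-1}))$, and $\mathfrak{g}[u,u^{-1}]$ is also viewed inside $\mathfrak{g}((u))$. $P_\alpha^-$ is the standard parabolic subalgebra of $\mathfrak{g}$ spanned by $\mathfrak{h}$, the root spaces of all negative roots and the root spaces of all positive roots which do not contain $\alpha$. $(P_\alpha^-)^\perp$ is its orthogonal complement in $\mathfrak{g}$ with respect to $K$. A Lie subalgebra $W$ is Lagrangian with respect to a nondegenerate invariant bilinear form if $W=W^\perp$. Two subspaces are transversal if the ambient space is their direct sum. *)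

(* Defs.v *)
From HB Require Import structures.
From mathcomp Require Import all_boot all_order all_algebra complex.
From mathcomp Require Import boolp classical_sets functions cardinality fsbigop.
From mathcomp Require Import reals constructive_ereal ereal.

Set Implicit Arguments.
Unset Strict Implicit.
Unset Printing Implicit Defensive.

Import Order.TTheory GRing.Theory Num.Theory.

Local Open Scope classical_set_scope.
Local Open Scope ring_scope.

(* vectType makes these Lie algebras finite dimensional. *)
HB.mixin Record Vector_isLie (K : fieldType) (g : Type) of Vector K g := {
  lieb : g -> g -> g;
  lieb_linearl : forall y, linear (lieb^~ y);
  lieb_linearr : forall x, linear (lieb x);
  liebxx : forall x, lieb x x = 0;
  lieb_jacobi : forall x y z,
    lieb x (lieb y z) + lieb y (lieb z x) + lieb z (lieb x y) = 0
}.

#[short(type="lieType")]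
HB.structure Definition Lie (K : fieldType) := {g of Vector_isLie K g & Vector K g}.

Section LinearSubsets.
Variables (K : fieldType) (V : lmodType K).

Definition is_subspace (U : set V) : Prop :=
  U 0 /\ forall (c : K) (x y : V), U x -> U y -> U (c *: x + y).

Definition lspan (A : set V) : set V := smallest is_subspace A.

Definition direct_sum (D U1 U2 : set V) : Prop :=
  D = [set x | exists y z, [/\ U1 y, U2 z & x = y + z]]
  /\ U1 `&` U2 = [set 0].

Variables (br : V -> V -> V) (D : set V) (Q : V -> V -> K).

Definition is_subalgebra (U : set V) : Prop :=
  is_subspace U /\ forall x y, U x -> U y -> U (br x y).

Definition orth_in (U : set V) : set V :=
  [set x | D x /\ forall y, U y -> Q x y = 0].

Definition lagrangian_subalgebra (W : set V) : Prop :=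
  [/\ W `<=` D, is_subalgebra W & W = orth_in W].

End LinearSubsets.

Section LieAlgebra.
Variables (K : fieldType) (g : lieType K).

Definition ad (x : g) : 'End(g) := linfun (lieb x).

Definition killing (x y : g) : K :=
  \tr (passmx.mxof (vbasis {:g}) (vbasis {:g}) (ad x \o ad y)%VF).

Definition simple_lie : Prop :=
  (exists x y : g, lieb x y != 0) /\
  forall I : {vspace g}, (forall x y : g, y \in I -> lieb x y \in I) ->
    I = 0%VS \/ I = fullv.

Definition liebv (U V : {vspace g}) : {vspace g} :=
  <<[seq lieb x y | x <- vbasis U, y <- vbasis V]>>%VS.

Definition nilpotent_lie (H : {vspace g}) : Prop :=
  exists n, iter n (liebv H) H = 0%VS.

Definition cartan_subalgebra (H : {vspace g}) : Prop :=
  [/\ forall x y, x \in H -> y \in H -> lieb x y \in H,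
      nilpotent_lie H
    & forall x, (forall y, y \in H -> lieb x y \in H) -> x \in H].

End LieAlgebra.

Section Roots.
Variables (K : fieldType) (g : lieType K) (H : {vspace g}).

Definition cartan_dual := 'Hom(subvs_of H, K^o).

Definition root_space (b : cartan_dual) : set g :=
  [set x | forall h : subvs_of H, lieb (vsval h) x = (b h : K) *: x].

Definition is_root (b : cartan_dual) : Prop :=
  b != 0 /\ exists2 x, x != 0 & root_space b x.

Variables (r : nat) (Gamma : r.-tuple cartan_dual).

Definition nat_comb (b : cartan_dual) : Prop :=
  exists c : 'I_r -> nat, b = \sum_(i < r) tnth Gamma i *+ c i.

Definition simple_roots : Prop :=
  [/\ basis_of fullv Gamma, forall i, is_root (tnth Gamma i)
    & forall b, is_root b -> nat_comb b \/ nat_comb (- b)].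

Definition positive_root (b : cartan_dual) : Prop := is_root b /\ nat_comb b.

Definition negative_root (b : cartan_dual) : Prop := is_root b /\ nat_comb (- b).

Definition contains_root (b : cartan_dual) (j : 'I_r) : Prop := coord Gamma j b != 0.

Definition maximal_root (t : cartan_dual) : Prop :=
  is_root t /\ forall b, is_root b -> nat_comb (t - b).

Definition parabolic_minus (j : 'I_r) : set g :=
  lspan ([set x | x \in H]
    `|` [set x | exists2 b, negative_root b & root_space b x]
    `|` [set x | exists2 b, positive_root b /\ ~ contains_root b j
                 & root_space b x]).

End Roots.

(* A formal series \sum_n f_n u^n is the function sending n to f_n. With this
   encoding g((u)), g((u^-1)) and g[u, u^-1] are subsets of int -> g. *)
Section Series.
Variable V : zmodType.

Definition laurent : set (int -> V) :=
  [set f | exists N : int, forall n : int, n < N -> f n = 0].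

Definition laurent_inv : set (int -> V) :=
  [set f | exists N : int, forall n : int, N < n -> f n = 0].

Definition laurent_poly : set (int -> V) := laurent `&` laurent_inv.

Definition power_series : set (int -> V) :=
  [set f | forall n : int, n < 0 -> f n = 0].

(* Extension of a biadditive map to series. The sum has finite support when
   f and h are both in laurent or both in laurent_inv; \sum_(i \in A) is 0 when
   the support is infinite. *)
Definition conv (A B : Type) (op : A -> B -> V) (f : int -> A) (h : int -> B)
    : int -> V :=
  fun n => \sum_(i \in [set: int]) op (f i) (h (n - i)).

End Series.

Section ScalarSeries.
Variable K : fieldType.

Definition monomial (m : int) : int -> K := fun n => (n == m)%:R.

Definition series_mul (f h : int -> K) : int -> K := conv *%R f h.

Definition residue (f : int -> K) : K := f (-1).

Definition tensor (V : lmodType K) (phi : int -> K) (x : V) : int -> V :=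
  fun n => phi n *: x.

End ScalarSeries.

Section Ambient.
Variables (K : fieldType) (g : lieType K).

(* (x, y) stands for x + \varepsilon y. *)
Definition eps_bracket (x y : g * g) : g * g :=
  (lieb x.1 y.1, lieb x.1 y.2 + lieb x.2 y.1).

Definition eps_form (x y : g * g) : K := killing x.1 y.2 + killing x.2 y.1.

Definition killing_series (f1 f2 : int -> g) : int -> K :=
  conv (@killing K g) f1 f2.

Definition ambient : set ((int -> g) * (g * g)) := @laurent g `*` setT.

Definition ambient_bracket (x y : (int -> g) * (g * g)) :
    (int -> g) * (g * g) :=
  (conv lieb x.1 y.1, eps_bracket x.2 y.2).

Definition ambient_form (a : int -> K) (x y : (int -> g) * (g * g)) : K :=
  residue (series_mul (monomial K (- 2)) (series_mul a (killing_series x.1 y.1)))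
  - killing x.2.2 y.2.1 - killing x.2.1 y.2.2.

Definition embedded_power_series : set ((int -> g) * (g * g)) :=
  [set (f, (f 0, f 1)) | f in @power_series g].

End Ambient.

Section Orders.
Variables (R : realType) (g : lieType R[i]) (H : {vspace g}).

(* The valuation of C((u^-1)); the infimum is a minimum for a nonzero series
   and +oo for the zero series. *)
Definition valuation_inv (phi : int -> R[i]) : \bar R :=
  ereal_inf [set (m%:~R : R)%:E | m in [set m : int | phi (- m) != 0]].

Definition real_cartan : set (subvs_of H) :=
  [set h | forall b : cartan_dual H, is_root b -> (b h : R[i]) \is Num.real].

(* The value b h is real for h in real_cartan, so that Re only changes its type. *)
Definition M_order (b : cartan_dual H) (h : subvs_of H) : set (int -> R[i]) :=
  [set phi | laurent_inv phi
             /\ ((complex.Re (b h))%:E <= valuation_inv phi)%E].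

Definition O_order (h : subvs_of H) : set (int -> g) :=
  lspan (
    [set f | (forall n, f n \in H) /\ forall n : int, 0 < n -> f n = 0]
    `|` [set f | exists b phi x, [/\ is_root b, M_order b h phi,
                   root_space b x & f = tensor phi x]]).

Variables (r : nat) (Gamma : r.-tuple (cartan_dual H)).

Definition order_point (amax : cartan_dual H) (j : 'I_r) (h : subvs_of H) : Prop :=
  real_cartan h /\
  forall i, (tnth Gamma i h : R[i]) = (i == j)%:R / coord Gamma j amax.

End Orders.

(* Main.v *)
Require Import Defs.
From HB Require Import structures.
From mathcomp Require Import all_boot all_order all_algebra complex.
From mathcomp Require Import boolp classical_sets functions cardinality fsbigop.
From mathcomp Require Import reals constructive_ereal ereal.
From mathcomp Require Import zify.

Set Implicit Arguments.
Unset Strict Implicit.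
Unset Printing Implicit Defensive.

Import Order.TTheory GRing.Theory Num.Theory.

Local Open Scope classical_set_scope.
Local Open Scope ring_scope.

(** The simple root [alpha] grades [g]: a root vector of root [b] gets as its
    degree the value of [b] at the point [hj], that is, the coefficient of
    [alpha] in [b] divided by [k]. In these terms the coefficient of [u ^ n] of
    an element of the order has degree at most [- n], and the Killing form only
    pairs opposite degrees.

    If [k > 1], a root vector [x] of [alpha] has degree [1 / k < 1], so that the
    constant series [x] is orthogonal to every series in the order: the form
    pairs it with the coefficient of [u], whose degree is at most [- 1]. A
    Lagrangian [W] inside the order would thus contain [x], although the constant
    terms of the order have degree at most 0 ([no_lagrangian_in_order]).

    If [k = 1], degrees are integers at most 1. The Laurent polynomials in the
    order are exactly those with coefficients of degree at most [- n] in
    [u ^ n] ([latticeP]), and they form a Lagrangian subalgebra of [g((u))]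
    ([lattice_isotropic], [lattice_coisotropic], [lattice_lieb]). A
    Lagrangian [W] inside the sum of this lattice and [g[eps]] contains the
    lattice, hence is its sum with a Lagrangian subalgebra [L] of [g[eps]]
    ([lagrangian_fiberE]), and every [L] occurs. Power series in the lattice have
    their first two coefficients in the parabolic [P] and in its orthogonal, so
    that [W] is transversal to [g[[u]]] exactly when [L] is transversal to
    [P + eps Pperp] ([prod_transversal]). The bijection sends [W] to [L].

    Two facts of structure theory enter. The Killing form of a simple [g] is zero
    or nondegenerate, since its radical is an ideal; when it is zero, both sets
    of Lagrangian subalgebras are empty. When it is nondegenerate, [g] is the sum
    of [H] and the root spaces ([weight_span_full]). Here [H] is abelian because the simple roots are a basis
    of its dual and have eigenvectors ([cartan_abelian]). For [x] in [H] the
    semisimple part of [ad x] is a derivation, so it is inner, given by an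
    element of [H] at which the simple roots take the same values as at [x]: it is
    [ad x] itself ([cartan_gen_eigen]). *)

(** * The semisimple part of an endomorphism *)

Section Subspaces.
Variables (K : fieldType) (V : lmodType K).
Implicit Types (U A : set V) (x y : V).

Lemma subspace0 U : is_subspace U -> U 0. Proof. by case. Qed.

Lemma subspaceD U x y : is_subspace U -> U x -> U y -> U (x + y).
Proof. by move=> [_ h] Ux Uy; rewrite -[x]scale1r; apply: h. Qed.

Lemma subspaceZ U c x : is_subspace U -> U x -> U (c *: x).
Proof. by move=> [U0 h] Ux; rewrite -[_ *: _]addr0; apply: h. Qed.

Lemma subspaceN U x : is_subspace U -> U x -> U (- x).
Proof. by move=> sU Ux; rewrite -scaleN1r; apply: subspaceZ. Qed.

Lemma subspaceB U x y : is_subspace U -> U x -> U y -> U (x - y).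
Proof. by move=> sU Ux Uy; apply: subspaceD => //; apply: subspaceN. Qed.

Lemma is_subspace_lspan A : is_subspace (lspan A).
Proof.
split=> [U [[]]//|c x y Ax Ay U [sU AU]].
by apply: (proj2 sU); [apply: Ax | apply: Ay].
Qed.

Lemma lspan_sub A U : is_subspace U -> A `<=` U -> lspan A `<=` U.
Proof. exact: smallest_sub. Qed.

Lemma sub_lspan A : A `<=` lspan A.
Proof. exact: sub_gen_smallest. Qed.

End Subspaces.

Section GeneralizedEigenvectors.
Variables (K : fieldType) (V : lmodType K) (T : {linear V -> V}).

Definition eig_shift (c : K) (v : V) : V := T v - c *: v.

Definition gen_eigen (c : K) (v : V) : Prop := exists k, iter k (eig_shift c) v = 0.

Lemma eig_shiftP c a v w :
  eig_shift c (a *: v + w) = a *: eig_shift c v + eig_shift c w.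
Proof.
rewrite /eig_shift linearP scalerBr scalerDr !scalerA [c * a]mulrC opprD.
by rewrite addrACA.
Qed.

Lemma iter_eig_shiftP c k a v w :
  iter k (eig_shift c) (a *: v + w) =
  a *: iter k (eig_shift c) v + iter k (eig_shift c) w.
Proof. by elim: k => //= k ->; rewrite eig_shiftP. Qed.

Lemma iter_eig_shift0 c k : iter k (eig_shift c) 0 = 0.
Proof. by elim: k => //= k ->; rewrite /eig_shift linear0 scaler0 subrr. Qed.

Lemma iter_eig_shift_leq c k m v : (k <= m)%N ->
  iter k (eig_shift c) v = 0 -> iter m (eig_shift c) v = 0.
Proof.
by move=> /subnK <- kv; rewrite iterD kv iter_eig_shift0.
Qed.

Lemma gen_eigen_subspace c : is_subspace (gen_eigen c).
Proof.
split=> [|a v w [k kv] [m mw]]; first by exists 0%N.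
exists (maxn k m); rewrite iter_eig_shiftP.
rewrite (iter_eig_shift_leq (leq_maxl k m)) //.
by rewrite (iter_eig_shift_leq (leq_maxr k m)) // scaler0 addr0.
Qed.

Lemma gen_eigen_eigen c v : T v = c *: v -> gen_eigen c v.
Proof. by move=> Tv; exists 1%N; rewrite /= /eig_shift Tv subrr. Qed.

(** [T - c] is invertible on generalized eigenvectors for [d != c]: the
    identity [(T - c) v - (T - d) v = (d - c) v] reduces a preimage of [v] to one
    of [(T - d) v], which dies one step earlier. *)
Lemma eig_shift_surj (J : set V) c d v : c != d -> is_subspace J ->
  (forall w, J w -> J (T w)) -> J v -> gen_eigen d v ->
  exists w, [/\ J w, gen_eigen d w & eig_shift c w = v].
Proof.
move=> cd sJ TJ Jv [k]; elim: k v Jv => [|k IH] v Jv.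
  move=> /= ->; exists 0; split; [exact: subspace0 | exact: subspace0 (gen_eigen_subspace _) |].
  by rewrite /eig_shift linear0 scaler0 subrr.
rewrite iterSr => kv.
have [|w [Jw dw ew]] := IH (eig_shift d v) _ kv.
  by apply: subspaceB => //; [exact: TJ | exact: subspaceZ].
exists ((d - c)^-1 *: (v - w)).
have dv : gen_eigen d v by exists k.+1; rewrite iterSr.
have gS := gen_eigen_subspace d.
split.
- by apply: subspaceZ => //; apply: subspaceB.
- by apply: subspaceZ => //; apply: subspaceB.
have h : eig_shift c (v - w) = (d - c) *: v.
  rewrite addrC -scaleN1r eig_shiftP ew scaleN1r /eig_shift opprB scalerBl.
  by rewrite addrA subrK.
rewrite -[_ *: _]addr0 eig_shiftP h scalerA mulVf ?subr_eq0 1?eq_sym //.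
by rewrite scale1r /eig_shift linear0 scaler0 subr0 addr0.
Qed.

(** Induction on the list. If [(T - c) v] is a sum of generalized eigenvectors,
    then an equation [(T - c) w = (T - c) v] can be solved for such a sum [w]
    up to an element of the generalized eigenspace of [c], and [v - w] lies in
    that eigenspace. The subspace [J] will be a joint eigenspace of operators
    commuting with [T]. *)
Lemma gen_eigen_span_killed (J : set V) (l : seq K) v : is_subspace J ->
  (forall w, J w -> J (T w)) -> J v -> foldr eig_shift v l = 0 ->
  lspan [set w | J w /\ exists c, gen_eigen c w] v.
Proof.
move=> sJ TJ; set U := lspan _.
have sU : is_subspace U by apply: is_subspace_lspan.
have sub c w : J w -> gen_eigen c w -> U w.
  by move=> Jw cw; apply: sub_lspan; split=> //; exists c.
have UJ w : U w -> J w by apply: lspan_sub => // x [].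
(* On the generalized eigenspace of c the error term absorbs w, so w' = 0 will
   do; on that of d != c the operator T - c is invertible. *)
have solve c w : U w ->
    exists w', [/\ U w', J (eig_shift c w' - w) & gen_eigen c (eig_shift c w' - w)].
  move=> Uw; suff: [set w | exists w', [/\ U w', J (eig_shift c w' - w) &
      gen_eigen c (eig_shift c w' - w)]] w by [].
  move: w Uw; apply: lspan_sub => [|w [Jw [d dw]]].
    split=> [|a x y [x' [Ux Jx cx]] [y' [Uy Jy cy]]].
      exists 0; have -> : eig_shift c 0 - 0 = 0.
        by rewrite /eig_shift linear0 scaler0 !subr0.
      split; first exact: subspace0; first exact: subspace0.
      exact: subspace0 (gen_eigen_subspace _).
    exists (a *: x' + y'); rewrite eig_shiftP opprD addrACA -scalerBr.
    split; [exact: (proj2 sU)|exact: (proj2 sJ)|].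
    exact: (proj2 (gen_eigen_subspace c)).
  have [ecd|cd] := eqVneq c d.
    have e0 : eig_shift c 0 - w = - w.
      by rewrite /eig_shift linear0 scaler0 subr0 sub0r.
    exists 0; rewrite e0; split; first exact: subspace0.
      exact: subspaceN.
    by apply: subspaceN (gen_eigen_subspace _) _; rewrite ecd.
  have [w' [Jw' dw' ew']] := eig_shift_surj cd sJ TJ Jw dw.
  exists w'; rewrite ew' subrr; split; [exact: sub dw'|exact: subspace0|].
  exact: subspace0 (gen_eigen_subspace _).
elim/last_ind: l v => [|l c IH] v Jv; first by move=> /= ->; apply: subspace0.
rewrite foldr_rcons => lv.
have Jcv : J (eig_shift c v).
  by apply: subspaceB => //; [exact: TJ | exact: subspaceZ].
have [w [Uw Jw [k kw]]] := solve c _ (IH _ Jcv lv).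
rewrite -(subrK w v); apply: (subspaceD sU) => //.
apply: (sub c); first by apply: (subspaceB sJ) => //; exact: UJ.
exists k.+1; rewrite iterSr.
have -> : eig_shift c (v - w) = - 1 *: (eig_shift c w - eig_shift c v) + 0.
  by rewrite (addrC v) -[- w]scaleN1r eig_shiftP !scaleN1r [in RHS]opprB addr0 addrC.
by rewrite iter_eig_shiftP kw scaler0 iter_eig_shift0 addr0.
Qed.

End GeneralizedEigenvectors.

Lemma coprimep_bezout1 (F : fieldType) (p q : {poly F}) :
  coprimep p q -> exists u v, u * p + v * q = 1.
Proof.
move=> /Bezout_coprimepP[[u v] /= /eqpP[[c1 c2] /andP[/= _ c20] h]].
exists ((c1 / c2) *: u), ((c1 / c2) *: v).
rewrite -!scalerAl -scalerDr mulrC -scalerA h scalerA mulVf //.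
by rewrite scale1r.
Qed.

(** Chinese remainders. Evaluated at an endomorphism with eigenvalues in [s],
    such a polynomial acts by the scalar [c] on the generalized eigenspace of
    [c], provided that [N] is large enough. *)
Lemma crt_shift (F : fieldType) (N : nat) (s : seq F) : uniq s ->
  exists p : {poly F}, forall c, c \in s -> ('X - c%:P) ^+ N %| p - c%:P.
Proof.
elim: s => [|a s IH] /=; first by exists 0.
move=> /andP[a_s /IH[p hp]].
pose m := \prod_(c <- s) ('X - c%:P) ^+ N.
have cop : coprimep (('X - a%:P) ^+ N) m.
  rewrite /m; elim: s a_s {IH hp m} => [|b s IH]; first by rewrite big_nil coprimep1.
  rewrite in_cons negb_or big_cons => /andP[ab /IH h].
  rewrite coprimepMr h andbT; apply/coprimep_expl/coprimep_expr.
  by rewrite coprimep_XsubC root_XsubC eq_sym.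
have [u [w huw]] := coprimep_bezout1 cop.
have hw : ('X - a%:P) ^+ N %| w * m - 1.
  by rewrite -huw opprD addrCA subrr addr0 dvdpNr dvdp_mull.
exists (p + (a%:P - p) * w * m) => c; rewrite in_cons => /orP[/eqP ->|cs].
  have -> : p + (a%:P - p) * w * m - a%:P = (a%:P - p) * (w * m - 1).
    by rewrite mulrBr mulr1 mulrA opprB [RHS]addrCA addrA.
  exact: dvdp_mull.
have -> : p + (a%:P - p) * w * m - c%:P = (p - c%:P) + (a%:P - p) * w * m.
  by rewrite addrAC.
apply: dvdp_add; first exact: hp.
by rewrite dvdp_mull // /m (big_rem c cs) /= dvdp_mulr.
Qed.

(** Let [t] be the multiplicity of [c] in the characteristic polynomial. Its
    cofactor is coprime to ['X - c], so by Cayley-Hamilton and Bezout a vector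
    killed by some power of [A - c] is killed by the [t]-th one; and
    [('X - c) ^ t] divides [p - c] for the polynomial [p] of [crt_shift]. *)
Lemma semisimple_part_mx (F : closedFieldType) n (A : 'M[F]_n.+1) :
  exists p : {poly F}, forall c k (v : 'rV[F]_n.+1),
    v *m (A - c%:M) ^+ k = 0 -> v *m horner_mx A p = c *: v.
Proof.
have [rs] := closed_field_poly_normal (char_poly A).
rewrite (monicP (char_poly_monic A)) scale1r => chiE.
have [p hp] := crt_shift (size rs) (undup_uniq rs).
exists p => c k v kv.
have hXc : horner_mx A ('X - c%:P) = A - c%:M.
  by rewrite rmorphB /= horner_mx_X horner_mx_C.
pose m := \prod_(z <- rs | z != c) ('X - z%:P).
pose t := count_mem c rs.
have hchi : char_poly A = ('X - c%:P) ^+ t * m.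
  rewrite chiE (bigID (pred1 c)) /=; congr (_ * _).
  rewrite (eq_bigr (fun=> 'X - c%:P)) => [|z /eqP -> //].
  by rewrite big_const_seq iter_mulr_1.
have cop : coprimep (('X - c%:P) ^+ k) m.
  apply: coprimep_expl; rewrite /m.
  elim/big_rec: _ => [|z q zc hq]; first by rewrite coprimep1.
  by rewrite coprimepMr hq andbT coprimep_XsubC root_XsubC.
have [u [w huw]] := coprimep_bezout1 cop.
have vt : v *m (A - c%:M) ^+ t = 0.
  rewrite -hXc -rmorphXn -[_ ^+ t]mul1r -huw mulrDl -[w * m * _]mulrA.
  rewrite [m * _]mulrC -hchi mulrAC [_ * (_ ^+ k)]mulrC rmorphD !rmorphM /=.
  rewrite Cayley_Hamilton mulr0 addr0 rmorphXn /= hXc.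
  by rewrite -[_ ^+ k * _]/(_ *m _) mulmxA kv mul0mx.
have [crs|crs] := boolP (c \in rs); last first.
  have v0 : v = 0 by move: vt; rewrite /t (count_memPn crs) expr0 mulmx1.
  by rewrite v0 mul0mx scaler0.
have /dvdpP [q hq] : ('X - c%:P) ^+ t %| p - c%:P.
  apply: dvdp_trans (hp c _); last by rewrite mem_undup.
  by apply: dvdp_exp2l; apply: count_size.
have : v *m horner_mx A (p - c%:P) = 0.
  rewrite hq mulrC rmorphM /= rmorphXn /= hXc -[_ ^+ t * _]/(_ *m _).
  by rewrite mulmxA vt mul0mx.
rewrite rmorphB /= horner_mx_C mulmxBr mul_mx_scalar.
by move/eqP; rewrite subr_eq0 => /eqP.
Qed.

Lemma linear_map0 (K : fieldType) (U V : lmodType K) (r : U -> V) : linear r -> r 0 = 0.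
Proof.
move=> /(_ 1 0 0); rewrite !scale1r addr0 => /eqP.
by rewrite -subr_eq0 opprD addNKr oppr_eq0 => /eqP.
Qed.

Section Endomorphisms.
Variables (F : closedFieldType) (V : vectType F).
Implicit Type T : 'End(V).

Import passmx.

Let e := vbasis {:V}.
Let eb : basis_of {:V} e := vbasisP _.

Lemma coordinates_eig_shift n (A : 'M[F]_n.+1) (T : 'End(V))
  (r : V -> 'rV[F]_n.+1) c v : linear r -> (forall v, r (T v) = r v *m A) ->
  r (eig_shift T c v) = r v *m (A - c%:M).
Proof.
move=> lr rT; rewrite /eig_shift addrC -scaleNr lr rT mulmxBr mul_mx_scalar.
by rewrite scaleNr addrC.
Qed.

(** Polynomials are evaluated at matrices of a size of the form [n.+1], hence
    this explicit size for the coordinates. *)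
Lemma endo_matrix T : (\dim {:V} != 0)%N -> exists n (A : 'M[F]_n.+1)
  (r : V -> 'rV[F]_n.+1) (s : 'rV[F]_n.+1 -> V),
  [/\ linear r, linear s, cancel r s, cancel s r & forall v, r (T v) = r v *m A].
Proof.
have lr := @rVof_linear _ _ e; have ls := @vecof_linear _ _ e.
have rK := rVofK eb; have sK := vecofK eb; have rA := rVof_app e eb T.
move: (rVof e) (vecof e) (mxof e e T) lr ls rK sK rA.
by case: (\dim _) => // n r s A *; exists n, A, r, s.
Qed.

Lemma dim0_eq0 (v : V) : \dim {:V} = 0%N -> v = 0.
Proof.
by move/eqP; rewrite dimv_eq0 => /eqP V0; apply/eqP; rewrite -memv0 -V0 memvf.
Qed.

Lemma semisimple_part T :
  exists S : 'End(V), forall c v, gen_eigen T c v -> S v = c *: v.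
Proof.
have [V0|/endo_matrix-/(_ T)] := eqVneq (\dim {:V}) 0%N.
  by exists 0 => c v _; rewrite (dim0_eq0 v V0) linear0 scaler0.
move=> [n [A [r [s [lr ls rK sK rT]]]]].
have [p hp] := semisimple_part_mx A.
have lS : linear (fun v => s (r v *m horner_mx A p)).
  by move=> a v w; rewrite lr mulmxDl -scalemxAl ls.
pose lm := GRing.isLinear.Build _ _ _ _ _ lS.
pose L : {linear V -> V} := HB.pack (fun v => s (r v *m horner_mx A p)) lm.
exists (linfun L) => c v [k kv]; rewrite lfunE /=.
have r0 := linear_map0 lr; have s0 := linear_map0 ls.
rewrite (hp c k) ?rK.
  by rewrite -[_ *: _]addr0 ls s0 addr0 rK.
rewrite -r0 -kv; elim: k {kv} => [|k IH]; first by rewrite expr0 mulmx1.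
by rewrite /= (coordinates_eig_shift _ _ lr rT) -IH exprSr mulmxA.
Qed.

Lemma gen_eigen_span T (J : set V) v : is_subspace J ->
  (forall w, J w -> J (T w)) -> J v ->
  lspan [set w | J w /\ exists c, gen_eigen T c w] v.
Proof.
move=> sJ TJ Jv.
suff [l hl] : exists l, foldr (eig_shift T) v l = 0 by apply: gen_eigen_span_killed hl.
have [V0|/endo_matrix-/(_ T)] := eqVneq (\dim {:V}) 0%N.
  by exists [::]; rewrite /= (dim0_eq0 v V0).
move=> [n [A [r [s [lr ls rK sK rT]]]]].
have r0 := linear_map0 lr.
have [rs] := closed_field_poly_normal (char_poly A).
rewrite (monicP (char_poly_monic A)) scale1r => chiE.
exists rs; apply: (can_inj rK); rewrite r0.
transitivity (r v *m horner_mx A (char_poly A)); last by rewrite Cayley_Hamilton mulmx0.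
rewrite chiE; elim: rs {chiE} => [|c rs IH] /=; first by rewrite big_nil rmorph1 mulmx1.
rewrite (coordinates_eig_shift _ _ lr rT) IH big_cons mulrC rmorphM /=.
rewrite -[horner_mx A _ * _]/(_ *m _) mulmxA; congr (_ *m _).
by rewrite rmorphB /= horner_mx_X horner_mx_C.
Qed.

End Endomorphisms.

(** * The Killing form *)

HB.instance Definition _ (K : fieldType) (g : lieType K) (x : g) :=
  GRing.isLinear.Build K g g _ (lieb x) (lieb_linearr x).

Section KillingForm.
Variables (K : fieldType) (g : lieType K).
Implicit Types (x y z : g) (f h : 'End(g)).

Import passmx.

Lemma liebPl c x y z : lieb (c *: x + y) z = c *: lieb x z + lieb y z.
Proof. exact: lieb_linearl. Qed.

Lemma liebDl x y z : lieb (x + y) z = lieb x z + lieb y z.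
Proof. by have := lieb_linearl z 1 x y; rewrite !scale1r. Qed.

Lemma lieb_anti x y : lieb x y = - lieb y x.
Proof.
apply/eqP; rewrite -addr_eq0; apply/eqP.
have := liebxx (x + y).
by rewrite liebDl !linearD /= !liebxx add0r addr0.
Qed.

Lemma lieb0l x : lieb 0 x = 0.
Proof. by rewrite lieb_anti linear0 oppr0. Qed.

Lemma liebNl x y : lieb (- x) y = - lieb x y.
Proof. by rewrite lieb_anti linearN /= opprK lieb_anti. Qed.

Lemma liebBl x y z : lieb (x - y) z = lieb x z - lieb y z.
Proof. by rewrite liebDl liebNl. Qed.

Lemma liebZl c x y : lieb (c *: x) y = c *: lieb x y.
Proof. by rewrite -[c *: x]addr0 liebPl lieb0l addr0. Qed.

Lemma lieb0r x : lieb x 0 = 0.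
Proof. exact: linear0. Qed.

Lemma liebZr c x y : lieb x (c *: y) = c *: lieb x y.
Proof. exact: linearZ. Qed.

Lemma lieb_leibniz x y z : lieb x (lieb y z) = lieb (lieb x y) z + lieb y (lieb x z).
Proof.
have := lieb_jacobi x y z; rewrite (lieb_anti z (lieb _ _)) (lieb_anti z x) linearN /=.
by move=> /eqP; rewrite subr_eq add0r subr_eq => /eqP.
Qed.

Lemma adE x y : ad x y = lieb x y.
Proof. by rewrite lfunE. Qed.

Lemma ad_linear : linear (@ad K g).
Proof.
move=> c x y; apply/lfunP => z.
by rewrite add_lfunE scale_lfunE !adE liebPl.
Qed.

Lemma ad_lieb x y : ad (lieb x y) = ((ad x \o ad y) - (ad y \o ad x))%VF.
Proof.
apply/lfunP => z; rewrite add_lfunE opp_lfunE !comp_lfunE !adE.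
by rewrite lieb_leibniz addrK.
Qed.

Definition endo_trace f : K := \tr (mxof (vbasis {:g}) (vbasis {:g}) f).

Lemma endo_trace_linear : linear (endo_trace : 'End(g) -> K^o).
Proof. by move=> c f h; rewrite /endo_trace !linearP. Qed.

HB.instance Definition _ :=
  GRing.isLinear.Build K 'End(g) K^o _ endo_trace endo_trace_linear.

Lemma endo_traceC f h : endo_trace (f \o h)%VF = endo_trace (h \o f)%VF.
Proof.
have eb := vbasisP {:g}.
by rewrite /endo_trace !(mxof_comp _ _ eb) mxtrace_mulC.
Qed.

Lemma killingE x y : killing x y = endo_trace (ad x \o ad y)%VF.
Proof. by []. Qed.

Lemma killingC x y : killing x y = killing y x.
Proof. by rewrite !killingE endo_traceC. Qed.

Lemma killing_linear x : linear (killing x : g -> K^o).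
Proof.
move=> c y z; rewrite !killingE ad_linear comp_lfunDr -comp_lfunZr.
by rewrite linearP.
Qed.

HB.instance Definition _ x := GRing.isLinear.Build K g K^o _ (killing x) (killing_linear x).

Lemma killing0r x : killing x 0 = 0. Proof. exact: linear0. Qed.
Lemma killing0l x : killing 0 x = 0. Proof. by rewrite killingC killing0r. Qed.
Lemma killingDr x y z : killing x (y + z) = killing x y + killing x z.
Proof. exact: linearD. Qed.
Lemma killingDl x y z : killing (x + y) z = killing x z + killing y z.
Proof. by rewrite killingC killingDr !(killingC z). Qed.
Lemma killingZr c x y : killing x (c *: y) = c * killing x y.
Proof. exact: linearZ. Qed.
Lemma killingZl c x y : killing (c *: x) y = c * killing x y.
Proof. by rewrite killingC killingZr killingC. Qed.
Lemma killingNr x y : killing x (- y) = - killing x y.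
Proof. exact: linearN. Qed.
Lemma killingNl x y : killing (- x) y = - killing x y.
Proof. by rewrite killingC killingNr killingC. Qed.

Lemma trace_comm_ad f h x : endo_trace (((f \o h) - (h \o f)) \o ad x)%VF =
  endo_trace (f \o ((h \o ad x) - (ad x \o h)))%VF.
Proof.
rewrite comp_lfunDl comp_lfunDr comp_lfunNl comp_lfunNr !linearB /=.
by rewrite -!comp_lfunA; congr (_ - _); rewrite endo_traceC comp_lfunA.
Qed.

Lemma killing_inv x y z : killing (lieb x y) z = killing x (lieb y z).
Proof. by rewrite !killingE !ad_lieb trace_comm_ad. Qed.

Definition killing_nondeg : Prop := forall x, (forall y, killing x y = 0) -> x = 0.

(** The map from [g] to its dual given by the Killing form, read as an
    endomorphism through the basis [vbasis]. *)
Let gram x : g := \sum_(i < \dim {:g}) killing x (vbasis {:g})`_i *: (vbasis {:g})`_i.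

Let gram_linear : linear gram.
Proof.
move=> c x y; rewrite /gram scaler_sumr -big_split; apply: eq_bigr => i _ /=.
by rewrite killingDl killingZl scalerDl scalerA.
Qed.

HB.instance Definition _ := GRing.isLinear.Build K g g _ gram gram_linear.

Let gram_eq x (phi : {linear g -> K^o}) :
  gram x = \sum_(i < \dim {:g}) phi (vbasis {:g})`_i *: (vbasis {:g})`_i ->
  forall y, killing x y = phi y.
Proof.
move=> h y; have eb := vbasisP {:g}; have fr := basis_free eb.
rewrite [y in LHS](coord_basis eb) ?memvf // [y in RHS](coord_basis eb) ?memvf //.
rewrite (linear_sum (killing x)) linear_sum; apply: eq_bigr => i _.
have := congr1 (coord (vbasis {:g}) i) h.
by rewrite !(coord_sum_free _ _ fr) /= killingZr linearZ /= => ->.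
Qed.

(** The radical of the Killing form is an ideal. *)
Lemma killing0_or_nondeg : simple_lie g -> (forall x y, killing x y = 0) \/ killing_nondeg.
Proof.
move=> [_ ideal01]; pose L : 'End(g) := linfun gram.
have radP x : x \in lker L <-> forall y, killing x y = 0.
  rewrite memv_ker lfunE /=; split=> [/eqP gx0 | h].
    have := @gram_eq x (\0 : {linear g -> K^o}); apply.
    by rewrite gx0 big1 // => i _; rewrite scale0r.
  by rewrite /gram big1 // => i _; rewrite h scale0r.
have [x y /radP yr|r0|rT] := ideal01 (lker L).
- by apply/radP => z; rewrite lieb_anti killingNl killing_inv yr oppr0.
- by right=> x /radP; rewrite r0 memv0 => /eqP.
- by left=> x; apply/radP; rewrite rT memvf.
Qed.

Hypothesis nondeg : killing_nondeg.

Lemma killing_represents (phi : {linear g -> K^o}) :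
  exists x, forall y, killing x y = phi y.
Proof.
pose L : 'End(g) := linfun gram.
have L0 : lker L == 0%VS.
  rewrite -subv0; apply/subvP => x; rewrite memv_ker memv0 lfunE /= => /eqP gx0.
  apply/eqP/nondeg; apply: (@gram_eq x (\0 : {linear g -> K^o})).
  by rewrite gx0 big1 // => i _; rewrite scale0r.
have /memv_imgP[x _ hx] :
    \sum_(i < \dim {:g}) phi (vbasis {:g})`_i *: (vbasis {:g})`_i \in limg L.
  by rewrite lker0_limgf // memvf.
by exists x; apply: gram_eq; rewrite hx lfunE.
Qed.

Lemma ad_inj x y : (forall z, lieb x z = lieb y z) -> x = y.
Proof.
move=> h; apply/eqP; rewrite -subr_eq0; apply/eqP; apply: nondeg => z.
have -> : x - y = -1 *: y + x by rewrite scaleN1r addrC.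
rewrite killingE ad_linear.
have -> : ad x = ad y by apply/lfunP => w; rewrite !adE h.
by rewrite scaleN1r addNr comp_lfun0l linear0.
Qed.

(** If the element y represents the functional tr(D o ad z), then E = D - ad y
    satisfies tr(E o ad z) = 0 for all z, so that, E being a derivation,
    K(E a, b) = tr([E, ad a] o ad b) = tr(E o ad [a, b]) = 0. *)
Lemma derivation_inner (D : 'End(g)) :
  (forall x y, D (lieb x y) = lieb (D x) y + lieb x (D y)) ->
  exists y, forall x, D x = lieb y x.
Proof.
move=> derD.
have lphi : linear (fun z => endo_trace (D \o ad z)%VF : K^o).
  by move=> c x y; rewrite ad_linear comp_lfunDr -comp_lfunZr linearP.
pose lm := GRing.isLinear.Build _ _ _ _ _ lphi.
pose phi : {linear g -> K^o} := HB.pack (fun z => endo_trace (D \o ad z)%VF) lm.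
have [y hy] := killing_represents phi.
pose E : 'End(g) := D - ad y.
have derE x z : E (lieb x z) = lieb (E x) z + lieb x (E z).
  rewrite /E !add_lfunE !opp_lfunE !adE derD lieb_leibniz opprD.
  by rewrite liebBl linearB /= addrACA.
have trE z : endo_trace (E \o ad z)%VF = 0.
  by rewrite comp_lfunDl comp_lfunNl linearB /= -killingE hy /= subrr.
exists y => x; apply/eqP; rewrite -subr_eq0.
have -> : D x - lieb y x = E x by rewrite add_lfunE opp_lfunE adE.
apply/eqP/nondeg => z; rewrite killingE.
have -> : ad (E x) = ((E \o ad x) - (ad x \o E))%VF.
  apply/lfunP => w; rewrite add_lfunE opp_lfunE !comp_lfunE !adE derE.
  by rewrite addrK.
by rewrite trace_comm_ad -ad_lieb trE.
Qed.

End KillingForm.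

(** * The root space decomposition *)

Section Weights.
Variables (K : fieldType) (g : lieType K) (H : {vspace g}).
Implicit Types (b c : cartan_dual H) (S T : set (cartan_dual H)) (x y : g).

Lemma root_space_lieb b c x y :
  root_space b x -> root_space c y -> root_space (b + c) (lieb x y).
Proof.
move=> bx cy h; rewrite lieb_leibniz bx cy liebZl linearZ /= -scalerDl.
by rewrite add_lfunE.
Qed.

Lemma killing_root_space_orth (h : subvs_of H) b c x y :
  root_space b x -> root_space c y -> (b h : K) + (c h : K) != 0 -> killing x y = 0.
Proof.
move=> bx cy bc0; have : ((b h : K) + (c h : K)) * killing x y = 0.
  rewrite mulrDl -killingZl -bx -killingZr -cy (lieb_anti _ x) killingNl.
  by rewrite killing_inv addNr.
by move/eqP; rewrite mulf_eq0 (negPf bc0) => /eqP.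
Qed.

(** The functional 0 is included because its root space is [H] itself
    ([root_space0]), so that Cartan elements and root vectors are treated alike. *)
Definition weight b : Prop := b = 0 \/ is_root b.

(** The parabolic, its orthogonal and the spaces of coefficients of the order
    are all of this form, for sets [S] cut out by the value of a weight at
    [hj]. *)
Definition weight_span S : set g :=
  lspan [set x | exists b, [/\ weight b, S b & root_space b x]].

Lemma weight_span_subspace S : is_subspace (weight_span S).
Proof. exact: is_subspace_lspan. Qed.

Lemma weight_span_root S b x : S b -> root_space b x -> weight_span S x.
Proof.
move=> Sb bx; have [->|x0] := eqVneq x 0; first exact: subspace0 (weight_span_subspace _).
apply: sub_lspan; exists b; split=> //.
by have [->|b0] := eqVneq b 0; [left | right; split=> //; exists x].
Qed.

Lemma weight_span_mono S T : (forall b, weight b -> S b -> T b) ->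
  weight_span S `<=` weight_span T.
Proof.
move=> ST; apply: lspan_sub; first exact: weight_span_subspace.
by move=> x [b [wb Sb bx]]; apply: weight_span_root bx; apply: ST.
Qed.

Lemma weight_span_lieb S T U x y :
  (forall b c, weight b -> weight c -> S b -> T c -> U (b + c)) ->
  weight_span S x -> weight_span T y -> weight_span U (lieb x y).
Proof.
move=> STU Sx Ty; have sU := weight_span_subspace U.
pose X := [set x | weight_span U (lieb x y)].
apply: (@lspan_sub _ _ _ X _ _ _ Sx).
  split=> [|k u v]; rewrite /X /= ?lieb0l ?liebPl; first exact: subspace0.
  exact: (proj2 sU).
move=> {Sx}{}x [b [wb Sb bx]]; pose Y := [set y | weight_span U (lieb x y)].
apply: (@lspan_sub _ _ _ Y _ _ _ Ty).
  split=> [|k u v]; rewrite /Y /= ?linear0 ?linearP; first exact: subspace0.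
  exact: (proj2 sU).
move=> y' [c [wc Tc cy]]; apply: weight_span_root (root_space_lieb bx cy).
exact: STU.
Qed.

Lemma weight_span_orth (h : subvs_of H) S T x y :
  (forall b c, weight b -> weight c -> S b -> T c -> (b h : K) + (c h : K) != 0) ->
  weight_span S x -> weight_span T y -> killing x y = 0.
Proof.
move=> ST Sx Ty; pose X := [set x | killing x y = 0].
apply: (@lspan_sub _ _ _ X _ _ _ Sx).
  split=> [|k u v]; rewrite /X /= ?killing0l // killingDl killingZl => -> ->.
  by rewrite mulr0 addr0.
move=> {Sx}{}x [b [wb Sb bx]]; pose Y := [set y | killing x y = 0].
apply: (@lspan_sub _ _ _ Y _ _ _ Ty).
  split=> [|k u v]; rewrite /Y /= ?killing0r // killingDr killingZr => -> ->.
  by rewrite mulr0 addr0.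
move=> y' [c [wc Tc cy]]; apply: killing_root_space_orth bx cy _.
exact: ST.
Qed.

Lemma weight_span_split S x : weight_span setT x ->
  exists y z, [/\ weight_span S y, weight_span (~` S) z & x = y + z].
Proof.
pose X := [set x | exists y z, [/\ weight_span S y, weight_span (~` S) z & x = y + z]].
have sS := weight_span_subspace; move=> Tx; apply: (@lspan_sub _ _ _ X _ _ _ Tx).
  split=> [|k _ _ [y [z [Sy Sz ->]]] [y' [z' [Sy' Sz' ->]]]].
    by exists 0, 0; split; [exact: subspace0|exact: subspace0|rewrite addr0].
  exists (k *: y + y'), (k *: z + z'); split; try exact: (proj2 (sS _)).
  by rewrite scalerDr addrACA.
move=> {Tx}{}x [b [wb _ bx]]; have [Sb|Sb] := pselect (S b).
  exists x, 0; split; [exact: weight_span_root bx | exact: subspace0 |].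
  by rewrite addr0.
exists 0, x; split; [exact: subspace0 | exact: weight_span_root bx |].
by rewrite add0r.
Qed.

Variables (r : nat) (Gamma : r.-tuple (cartan_dual H)).
Hypothesis (H_cartan : cartan_subalgebra H) (Gamma_simple : simple_roots Gamma).

Lemma cartan_dual_ext_Gamma (h : subvs_of H) :
  (forall i, (tnth Gamma i h : K) = 0) -> h = 0.
Proof.
move=> Gh; have [Gb _ _] := Gamma_simple.
have b0 b : (b h : K) = 0.
  rewrite (coord_basis Gb (memvf b)) sum_lfunE big1 // => i _.
  by rewrite scale_lfunE -tnth_nth Gh scaler0.
rewrite (coord_vbasis (memvf h)) big1 // => i _.
pose p : {linear subvs_of H -> K^o} := coord (vbasis fullv) i.
have : linfun p h = 0 by apply: (b0 (linfun p)).
by rewrite lfunE /= => ->; rewrite scale0r.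
Qed.

(** Each simple root [b] has a true eigenvector, on which [[x, y]] acts both by
    [b [x, y]] and by a commutator of scalars; and the simple roots separate
    the points of [H]. *)
Lemma cartan_abelian x y : x \in H -> y \in H -> lieb x y = 0.
Proof.
move=> xH yH; have [HH _ _] := H_cartan; have wH := HH x y xH yH.
have [_ Gr _] := Gamma_simple.
suff : vsproj H (lieb x y) = 0 by move/(congr1 vsval); rewrite vsprojK // linear0.
apply: cartan_dual_ext_Gamma => i; have [_ [v v0 bv]] := Gr i.
have := bv (vsproj H (lieb x y)); rewrite vsprojK //.
have bx := bv (vsproj H x); have by_ := bv (vsproj H y).
rewrite !vsprojK // in bx by_.
have -> : lieb (lieb x y) v = lieb x (lieb y v) - lieb y (lieb x v).
  by rewrite lieb_leibniz addrK.
rewrite by_ bx !liebZr bx by_ !scalerA mulrC subrr => /eqP.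
by rewrite eq_sym scaler_eq0 (negPf v0) orbF => /eqP.
Qed.

Lemma root_space0 x : root_space (0 : cartan_dual H) x <-> x \in H.
Proof.
have [_ _ Hnorm] := H_cartan; split=> [x0|xH h]; last first.
  by rewrite cartan_abelian ?subvsP // lfunE scale0r.
apply: Hnorm => y yH; rewrite lieb_anti; have := x0 (vsproj H y).
by rewrite vsprojK // lfunE scale0r => ->; rewrite oppr0 mem0v.
Qed.

End Weights.

Section Diagonalization.
Variables (K : closedFieldType) (g : lieType K) (H : {vspace g}).
Variables (r : nat) (Gamma : r.-tuple (cartan_dual H)).
Hypothesis (H_cartan : cartan_subalgebra H) (Gamma_simple : simple_roots Gamma).
Hypothesis nondeg : killing_nondeg g.

Lemma gen_eigen_spanT (T : 'End(g)) (U : set g) : is_subspace U ->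
  (forall c v, gen_eigen T c v -> U v) -> forall v, U v.
Proof.
move=> sU h v; have : lspan [set w | [set: g] w /\ exists c, gen_eigen T c w] v.
  exact: gen_eigen_span.
by apply: lspan_sub => // w [_ [c cw]]; apply: h cw.
Qed.

Lemma eig_shift_ad (x : g) c v : eig_shift (ad x) c v = lieb x v - c *: v.
Proof. by rewrite /eig_shift /= adE. Qed.

(** The identity
    [(ad x - c - d) [v, w] = [(ad x - c) v, w] + [v, (ad x - d) w]]
    lowers the total exponent needed to kill [v] and [w]. *)
Lemma gen_eigen_lieb (x : g) c d v w : gen_eigen (ad x) c v -> gen_eigen (ad x) d w ->
  gen_eigen (ad x) (c + d) (lieb v w).
Proof.
move=> [m mv] [n nw]; exists (m + n)%N.
have sh0 k : iter k (eig_shift (ad x) (c + d)) 0 = 0 by exact: iter_eig_shift0.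
have [N] := ubnP (m + n); elim: N m n v w mv nw => // N IH m n v w mv nw.
case: m mv => [|m mv]; first by rewrite [iter 0 _ v]/= => ->; rewrite lieb0l sh0.
case: n nw => [|n nw]; first by rewrite [iter 0 _ w]/= => ->; rewrite lieb0r sh0.
rewrite addSn ltnS => hN; rewrite iterSr.
have -> : eig_shift (ad x) (c + d) (lieb v w) =
    1 *: lieb (eig_shift (ad x) c v) w + lieb v (eig_shift (ad x) d w).
  rewrite scale1r !eig_shift_ad lieb_leibniz liebBl linearB /= liebZl liebZr.
  by rewrite scalerDl opprD addrACA.
rewrite iter_eig_shiftP scale1r (IH m n.+1 (eig_shift (ad x) c v)) -?iterSr // add0r.
by rewrite addnS -addSn (IH m.+1 n v (eig_shift (ad x) d w)) -?iterSr // addSn -addnS.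
Qed.

(** The semisimple part of [ad x] is a derivation commuting with [ad H], hence
    is [ad y] for some [y] in [H]. A simple root takes the same value at [x]
    and at [y], since its eigenvector is a true one; so [y = x]. *)
Lemma cartan_gen_eigen (x : g) c v : x \in H -> gen_eigen (ad x) c v ->
  lieb x v = c *: v.
Proof.
move=> xH cv; have [S hS] := semisimple_part (ad x).
have [_ _ Hnorm] := H_cartan.
have derS u w : S (lieb u w) = lieb (S u) w + lieb u (S w).
  pose U1 := [set u | forall w, S (lieb u w) = lieb (S u) w + lieb u (S w)].
  apply: (@gen_eigen_spanT (ad x) U1) => [|a {}u au {}w].
    split=> [w'|k a b ha hb w']; first by rewrite linear0 !lieb0l linear0 addr0.
    by rewrite linearP /= !liebPl linearP /= ha hb scalerDr addrACA.
  pose U2 := [set w | S (lieb u w) = lieb (S u) w + lieb u (S w)].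
  apply: (@gen_eigen_spanT (ad x) U2) => [|b {}w bw].
    split=> [|k a' b]; rewrite /U2 /=; first by rewrite !linear0 addr0.
    by move=> ha hb; rewrite !linearP /= ha hb scalerDr addrACA.
  rewrite /U2 /= (hS a u au) (hS b w bw) (hS (a + b)); last exact: gen_eigen_lieb.
  by rewrite liebZl linearZ /= scalerDl.
have [y hy] := derivation_inner nondeg derS.
have yH : y \in H.
  apply: Hnorm => h hH; suff -> : lieb y h = 0 by apply: mem0v.
  apply: (ad_inj nondeg) => w; rewrite lieb0l.
  have -> : lieb (lieb y h) w = lieb y (lieb h w) - lieb h (lieb y w).
    by rewrite lieb_leibniz addrK.
  apply/eqP; rewrite subr_eq0; apply/eqP; rewrite -!hy.
  pose U := [set w | S (lieb h w) = lieb h (S w)].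
  apply: (@gen_eigen_spanT (ad x) U) => [|a {}w [k kw]].
    split=> [|k a b]; rewrite /U /=; first by rewrite !linear0.
    by rewrite !linearP /= => -> ->.
  have aw : gen_eigen (ad x) a w by exists k.
  rewrite /U /= (hS a w aw) linearZ /=; apply: hS; exists k.
  suff -> : iter k (eig_shift (ad x) a) (lieb h w) = lieb h (iter k (eig_shift (ad x) a) w).
    by rewrite kw linear0.
  elim: k {kw} => //= k ->; rewrite !eig_shift_ad linearB /=.
  have xh0 : lieb x h = 0 by apply: (cartan_abelian H_cartan Gamma_simple).
  by rewrite lieb_leibniz xh0 lieb0l add0r liebZr.
suff -> : x = y by rewrite -hy; apply: hS.
suff : vsproj H x - vsproj H y = 0.
  move/eqP; rewrite subr_eq0 => /eqP /(congr1 vsval).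
  by rewrite !vsprojK.
apply: (cartan_dual_ext_Gamma Gamma_simple) => i; have [_ Gr _] := Gamma_simple.
have [_ [w w0 bw]] := Gr i.
have bx := bw (vsproj H x); have by_ := bw (vsproj H y).
rewrite !vsprojK // in bx by_.
have : lieb y w = (tnth Gamma i (vsproj H x) : K) *: w.
  by rewrite -hy; apply: hS; apply: gen_eigen_eigen; rewrite /= adE.
rewrite by_ => /eqP; rewrite -subr_eq0 -scalerBl scaler_eq0 (negPf w0) orbF.
by rewrite linearB /= subr_eq0 eq_sym -subr_eq0 => /eqP.
Qed.

(** The operators [ad h] commute and are diagonalizable; they are diagonalized
    one after the other, each within a joint eigenspace of the previous ones. *)
Lemma joint_eigen_span (s : seq g) v : {subset s <= H} ->
  lspan [set w | forall h, h \in s -> exists c, lieb h w = c *: w] v.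
Proof.
elim: s v => [|h s IH] v sH; first by apply: sub_lspan => h.
have hH : h \in H by apply: sH; rewrite mem_head.
have {}sH : {subset s <= H} by move=> x xs; apply: sH; rewrite in_cons xs orbT.
apply: (lspan_sub (is_subspace_lspan _) _ (IH v sH)) => w ws.
(* A subspace of joint eigenvectors with the eigenvalues of w, stable under ad h. *)
pose J := [set u | forall x c, x \in s -> lieb x w = c *: w -> lieb x u = c *: u].
have sJ : is_subspace J.
  split=> [x c _ _|k a b Ja Jb x c xs xw]; first by rewrite linear0 scaler0.
  by rewrite linearP /= (Ja x c) // (Jb x c) // scalerDr !scalerA mulrC.
have TJ u : J u -> J (ad h u).
  move=> Ju x c xs xw.
  have xh0 : lieb x h = 0 by apply: (cartan_abelian H_cartan Gamma_simple) => //; apply: sH.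
  by rewrite adE lieb_leibniz xh0 lieb0l add0r (Ju x c) // liebZr.
have Jw : J w by [].
apply: (lspan_sub (is_subspace_lspan _) _ (gen_eigen_span sJ TJ Jw)) => u [Ju [c cu]].
apply: sub_lspan => x; rewrite in_cons => /orP[/eqP ->|xs].
  by exists c; apply: cartan_gen_eigen.
by have [d xw] := ws x xs; exists d; apply: Ju.
Qed.

(** The eigenvalue of [h] on a nonzero joint eigenvector is linear in [h]. *)
Lemma weight_span_full (v : g) : weight_span (setT : set (cartan_dual H)) v.
Proof.
have sH : {subset vbasis H <= H} by move=> x; apply: vbasis_mem.
apply: (lspan_sub (weight_span_subspace _) _ (joint_eigen_span v sH)) => w wH.
have [->|w0] := eqVneq w 0; first exact: subspace0 (weight_span_subspace _).
have ex (h : subvs_of H) : exists c, lieb (vsval h) w = c *: w.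
  rewrite (coord_vbasis (subvsP h)).
  elim/big_ind: _ => [|a b [c ha] [d hb]|i _].
  - by exists 0; rewrite lieb0l scale0r.
  - by exists (c + d); rewrite liebDl ha hb -scalerDl.
  - have [c hc] := wH _ (mem_tnth i (vbasis H)); rewrite (tnth_nth 0) in hc.
    by exists (coord (vbasis H) i (vsval h) * c); rewrite liebZl hc scalerA.
pose f h := projT1 (cid (ex h)).
have fE h : lieb (vsval h) w = f h *: w := projT2 (cid (ex h)).
have lf : linear (f : subvs_of H -> K^o).
  move=> c a b; apply/eqP; rewrite -subr_eq0.
  have /eqP : (f (c *: a + b) - (c * f a + f b)) *: w = 0.
    by rewrite scalerBl scalerDl -scalerA -!fE linearP /= liebPl subrr.
  by rewrite scaler_eq0 (negPf w0) orbF.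
pose lm := GRing.isLinear.Build _ _ _ _ _ lf.
pose fl : {linear subvs_of H -> K^o} := HB.pack (f : subvs_of H -> K^o) lm.
by apply: (@weight_span_root _ _ _ _ (linfun fl)) => // h; rewrite lfunE.
Qed.

End Diagonalization.

(** * Formal series *)

Section SeriesLemmas.
Variable V : zmodType.

Lemma conv0 (A B : Type) (op : A -> B -> V) f h n :
  (forall i, op (f i) (h (n - i)) = 0) -> conv op f h n = 0.
Proof. by move=> z; apply: fsbig1 => i _; apply: z. Qed.

Lemma conv_single (A B : Type) (op : A -> B -> V) f h n m :
  (forall i, i != m -> op (f i) (h (n - i)) = 0) ->
  conv op f h n = op (f m) (h (n - m)).
Proof.
move=> z; rewrite /conv -(@fsbig_widen _ _ _ _ [set m]) ?fsbig_set1 //.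
by move=> i [_ /= im]; apply: z; apply/eqP.
Qed.

Lemma conv_pred (A B : Type) (op : A -> B -> V) (U : set V) f h n :
  U 0 -> (forall x y, U x -> U y -> U (x + y)) ->
  (forall i, U (op (f i) (h (n - i)))) -> U (conv op f h n).
Proof. by move=> U0 UD Uf; rewrite /conv; elim/big_ind: _ => // i _; apply: Uf. Qed.

End SeriesLemmas.

Section DeltaSeries.
Variables (K : fieldType) (V : lmodType K).
Implicit Types (x : V) (f : int -> V).

Lemma tensor_monomialE m x n : tensor (monomial K m) x n = if n == m then x else 0.
Proof. by rewrite /tensor /monomial; case: eqP; rewrite ?scale1r ?scale0r. Qed.

Lemma tensor_monomial_poly m x : @laurent_poly V (tensor (monomial K m) x).
Proof.
split; exists m => n mn; rewrite tensor_monomialE ifN //.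
  by rewrite lt_eqF.
by rewrite gt_eqF.
Qed.

(** A Laurent polynomial is the sum of its terms. *)
Lemma laurent_poly_ind (U : set (int -> V)) f : is_subspace U -> laurent_poly f ->
  (forall n, U (tensor (monomial K n) (f n))) -> U f.
Proof.
move=> sU [[N fN] [M fM]] Uf.
have {M fM} [k fk] : exists k : nat, forall n, N + k%:Z <= n -> f n = 0.
  by exists (absz (M + 1 - N)%R) => n hn; apply: fM; lia.
elim: k f fN fk Uf => [|k IH] f fN fk Uf.
  have -> : f = 0.
    apply/funext => n; have [nN|nN] := ltP n N; first exact: fN.
    by apply: fk; rewrite addr0.
  exact: subspace0.
set m := N + k%:Z; rewrite -(subrK (tensor (monomial K m) (f m)) f).
have fE n : (f - tensor (monomial K m) (f m)) n = if n == m then 0 else f n.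
  rewrite -[LHS]/(f n - tensor (monomial K m) (f m) n) tensor_monomialE.
  by case: eqP => [->|_]; rewrite ?subrr ?subr0.
apply: (subspaceD sU _ (Uf m)); apply: IH => [n nN|n nk|n].
- by rewrite fE fN // if_same.
- rewrite fE; case: eqP => // nm; apply: fk.
  by rewrite intS; move: nk nm; rewrite /m; lia.
- rewrite fE; case: eqP => _ //.
  have -> : tensor (monomial K n) 0 = 0 :> (int -> V).
    by apply/funext => i; rewrite /tensor scaler0.
  exact: subspace0.
Qed.

Lemma series_mul_monomial m (f : int -> K) n : series_mul (monomial K m) f n = f (n - m).
Proof.
rewrite /series_mul (@conv_single _ _ _ _ _ _ _ m) => [|i /negPf im].
  by rewrite /monomial eqxx mul1r.
by rewrite /monomial im mul0r.
Qed.

Lemma ambient_formE (g : lieType K) (w w' : (int -> g) * (g * g)) :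
  ambient_form (monomial K 0) w w' =
  conv (@killing K g) w.1 w'.1 1 - eps_form w.2 w'.2.
Proof.
rewrite /ambient_form /residue !series_mul_monomial /killing_series.
have -> : -1 - -2 - 0 = 1 :> int by [].
by rewrite /eps_form (opprD (killing _ _)) addrA addrAC.
Qed.

End DeltaSeries.

(** * The order attached to a simple root *)

Section Degrees.
Variables (R : realType) (g : lieType R[i]) (H : {vspace g}).
Hypothesis H_cartan : cartan_subalgebra H.
Variables (r : nat) (Gamma : r.-tuple (cartan_dual H)).
Hypothesis Gamma_simple : simple_roots Gamma.
Variables (amax : cartan_dual H) (j : 'I_r) (hj : subvs_of H).
Hypothesis hjP : order_point Gamma amax j hj.

Implicit Types (b c : cartan_dual H) (m n : int) (x y : g) (f : int -> g).

(** The degree of a weight [b] is its value at [hj], that is, its coefficient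
    at [alpha] divided by [k]. *)
Definition degree_le m : set g :=
  weight_span [set b : cartan_dual H | (b hj : R[i]) <= m%:~R].

Lemma degree_le_subspace m : is_subspace (degree_le m).
Proof. exact: weight_span_subspace. Qed.

Lemma cartan_degree_le m x : 0 <= m -> x \in H -> degree_le m x.
Proof.
move=> m0 /(root_space0 H_cartan Gamma_simple) x0.
by apply: weight_span_root x0; rewrite /= lfunE ler0z.
Qed.

Lemma degree_le_lieb m n x y :
  degree_le m x -> degree_le n y -> degree_le (m + n) (lieb x y).
Proof.
apply: weight_span_lieb => b c _ _ /= bm cn.
by rewrite add_lfunE intrD lerD.
Qed.

Lemma degree_le_orth m n x y : m + n < 0 ->
  degree_le m x -> degree_le n y -> killing x y = 0.
Proof.
move=> mn; apply: (@weight_span_orth _ _ _ hj) => b c _ _ /= bm cn.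
rewrite lt_eqF // (le_lt_trans (lerD bm cn)) //.
by rewrite -intrD ltrz0.
Qed.

Lemma cartan_dual_evalE b : (b hj : R[i]) = coord Gamma j b / coord Gamma j amax.
Proof.
have [_ hG] := hjP; have [Gb _ _] := Gamma_simple.
rewrite [b in LHS](coord_basis Gb (memvf b)) sum_lfunE (bigD1 j) //=.
rewrite big1 => [|i ij]; rewrite scale_lfunE -tnth_nth hG.
  by rewrite eqxx addr0 mul1r.
by rewrite (negPf ij) mul0r scaler0.
Qed.

Lemma nat_comb_coord b : nat_comb Gamma b -> exists n : nat, coord Gamma j b = n%:R.
Proof.
have [Gb _ _] := Gamma_simple; move=> [c ->]; exists (c j).
rewrite linear_sum (bigD1 j) //= big1 => [|i ij].
  rewrite (tnth_nth 0) linearMn /= coord_free ?eqxx ?addr0 //.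
  exact: basis_free Gb.
rewrite (tnth_nth 0) linearMn /= coord_free; last exact: basis_free Gb.
by rewrite (negPf ij) mul0rn.
Qed.

(** A series in [M_b] only has exponents [n <= - b hj]. *)
Lemma O_order_degree f n : O_order hj f -> degree_le (- n) (f n).
Proof.
move=> Of; pose U : set (int -> g) := [set f | forall n, degree_le (- n) (f n)].
have : U f; last by apply.
move: f Of; apply: lspan_sub => [|f [[fH f0]|[b [phi [x [rb [_ Mphi] bx ->]]]]] {}n].
- split=> [n'|c f h Uf Uh n']; first exact: subspace0 (degree_le_subspace _).
  exact: (proj2 (degree_le_subspace _)).
- have [n0|n0] := ltP 0 n; first by rewrite f0 //; apply: subspace0 (degree_le_subspace _).
  by apply: cartan_degree_le (fH n); rewrite oppr_ge0.
rewrite /tensor; have [->|phin] := eqVneq (phi n) 0.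
  by rewrite scale0r; apply: subspace0 (degree_le_subspace _).
apply: (subspaceZ _ (degree_le_subspace _)); apply: weight_span_root bx => /=.
have [hreal _] := hjP; rewrite -(RRe_real (hreal b rb)).
rewrite -[_%:~R](rmorph_int (real_complex R)) lecR -lee_fin.
apply: (le_trans Mphi); apply: ereal_inf_lbound; exists (- n) => //=.
by rewrite opprK.
Qed.

(** For [k > 1] a root vector [x] of degree [1 / k], placed in [u]-degree 0, is
    orthogonal to [w.1 1], which has degree at most [- 1]; hence [x] belongs to
    [W], although its degree is positive. *)
Lemma no_lagrangian_in_order (W : set ((int -> g) * (g * g))) :
  killing_nondeg g -> 1 < coord Gamma j amax ->
  W = orth_in (@ambient _ g) (ambient_form (monomial R[i] 0)) W ->
  W `<=` (O_order hj `&` @laurent_poly g) `*` [set: g * g] -> False.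
Proof.
move=> nondeg k1 WE WO; have k0 : 0 < coord Gamma j amax by apply: lt_trans k1.
have [_ Gr _] := Gamma_simple; have [_ [x x0 bx]] := Gr j.
have ghj : (tnth Gamma j hj : R[i]) = (coord Gamma j amax)^-1.
  by have [_ ->] := hjP; rewrite eqxx mul1r.
have xspan : weight_span [set tnth Gamma j] x by apply: weight_span_root bx.
have Wx : W (tensor (monomial R[i] 0) x, (0, 0)).
  rewrite WE; split; first by split=> //; have [] := tensor_monomial_poly 0 x.
  move=> w /WO [[Ow _] _]; rewrite ambient_formE /eps_form /= !killing0l addr0 subr0.
  rewrite (@conv_single _ _ _ _ _ _ _ 0) => [|i /negPf i0]; last first.
    by rewrite tensor_monomialE i0 killing0l.
  rewrite tensor_monomialE eqxx subr0.
  apply: (@weight_span_orth _ _ _ hj _ _ _ _ _ xspan (O_order_degree (n := 1) Ow)).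
  move=> _ c _ _ /= -> cle; rewrite ghj lt_eqF // (le_lt_trans (lerD (lexx _) cle)) //.
  by rewrite mulrN1z subr_lt0 invf_lt1.
have xneg : degree_le 0 x.
  have [[Ox _] _] := WO _ Wx; have := O_order_degree (n := 0) Ox.
  by rewrite /= tensor_monomialE eqxx oppr0.
suff x0' : x = 0 by rewrite x0' eqxx in x0.
apply: (nondeg x) => y.
have yT : weight_span [set: cartan_dual H] y.
  exact: (weight_span_full H_cartan Gamma_simple nondeg).
pose S := [set c : cartan_dual H | (c hj : R[i]) < 0].
have [y1 [y2 [hy1 hy2 ->]]] := weight_span_split S yT.
rewrite killingDr (@weight_span_orth _ _ _ hj _ _ _ _ _ xneg hy1).
  rewrite add0r (@weight_span_orth _ _ _ hj _ _ _ _ _ xspan hy2) //.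
  move=> _ c _ wc /= -> nc; have creal : (c hj : R[i]) \is Num.real.
    by case: wc => [->|rc]; [rewrite lfunE /= real0 | apply: (proj1 hjP)].
  have c0 : 0 <= (c hj : R[i]) by case: real_ltP nc; rewrite ?real0.
  by rewrite gt_eqF // ghj ltr_pwDl ?invr_gt0.
by move=> b c _ _ /= bm cm; rewrite lt_eqF // -[ltRHS]addr0 ler_ltD.
Qed.

End Degrees.

(** * Coefficient one: the order is a Lagrangian lattice *)

Section CoefficientOne.
Variables (R : realType) (g : lieType R[i]) (H : {vspace g}).
Hypothesis H_cartan : cartan_subalgebra H.
Variables (r : nat) (Gamma : r.-tuple (cartan_dual H)).
Hypothesis Gamma_simple : simple_roots Gamma.
Variables (amax : cartan_dual H) (j : 'I_r) (hj : subvs_of H).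
Hypothesis hjP : order_point Gamma amax j hj.
Hypothesis amax_maximal : maximal_root Gamma amax.
Hypothesis nondeg : killing_nondeg g.
Hypothesis amax_coef1 : coord Gamma j amax = 1.

Implicit Types (b c : cartan_dual H) (m n : int) (x y : g) (f : int -> g).

Local Notation degree_le := (degree_le hj).
Local Notation lattice := (O_order hj `&` @laurent_poly g).

Let degree_sub m : is_subspace (degree_le m) := degree_le_subspace hj m.

Lemma cartan_dual_eval_coord b : (b hj : R[i]) = coord Gamma j b.
Proof. by rewrite (cartan_dual_evalE Gamma_simple hjP) amax_coef1 divr1. Qed.

(** The difference between the maximal root, of degree 1, and any root has a
    natural number as its degree. *)
Lemma weight_degree b : weight b -> exists m : int, (b hj : R[i]) = m%:~R /\ m <= 1.
Proof.
move=> [->|rb]; first by exists 0; rewrite lfunE.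
have [_ /(_ b rb) /(nat_comb_coord Gamma_simple j) [n]] := amax_maximal.
rewrite linearB /= amax_coef1 -cartan_dual_eval_coord => hn.
exists (1 - n%:Z); split; last by lia.
by rewrite intrB -[(n%:Z)%:~R]/(n%:R) -hn opprB addrC subrK.
Qed.

Lemma degree_le_full m x : 1 <= m -> degree_le m x.
Proof.
move=> m1; have := weight_span_full H_cartan Gamma_simple nondeg x.
apply: weight_span_mono => b wb _ /=; have [n [-> n1]] := weight_degree wb.
by rewrite ler_int (le_trans n1).
Qed.

(** Subtracting from [x] its components of degree at most [- m - 1], which are
    orthogonal to [degree_le m], leaves a vector [z] with components of degree at
    least [- m]: it is orthogonal to [degree_le m], and also to all weight
    vectors of degree at least [m + 1]. Degrees being integers, these two cases
    cover [g], so that [z = 0]. *)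
Lemma degree_le_perp m x : (forall y, degree_le m y -> killing x y = 0) ->
  degree_le (- m - 1) x.
Proof.
move=> xm; have full := weight_span_full H_cartan Gamma_simple nondeg.
pose S n : set (cartan_dual H) := [set b | (b hj : R[i]) <= n%:~R].
have [y [z [yS zS xE]]] := weight_span_split (S (- m - 1)) (full x).
suff z0 : z = 0 by rewrite xE z0 addr0.
have zm w : degree_le m w -> killing z w = 0.
  move=> mw; have := xm w mw; rewrite xE killingDl.
  by rewrite (degree_le_orth _ yS mw) ?add0r //; lia.
apply: nondeg => w; have [w1 [w2 [w1S w2S ->]]] := weight_span_split (S m) (full w).
rewrite killingDr zm // add0r.
apply: (@weight_span_orth _ _ _ hj _ _ _ _ _ zS w2S) => b c wb wc; rewrite /S /setC /=.
have [p [-> _]] := weight_degree wb; have [q [-> _]] := weight_degree wc.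
rewrite !ler_int => /negP; rewrite -ltNge => hp /negP; rewrite -ltNge => hq.
by rewrite -intrD intr_eq0; lia.
Qed.

Lemma degree_le_eq0 m x : m <= -2 -> degree_le m x -> x = 0.
Proof.
move=> m2 mx; apply: nondeg => y.
by apply: (degree_le_orth _ mx (degree_le_full y (lexx 1))); lia.
Qed.

Lemma parabolicE : parabolic_minus Gamma j = degree_le 0.
Proof.
have [_ _ Gpm] := Gamma_simple.
apply/seteqP; split; apply: lspan_sub; try exact: is_subspace_lspan.
- move=> x [[xH|[b [rb nb] bx]]|[b [_ nj] bx]].
  + exact: (cartan_degree_le H_cartan Gamma_simple).
  + apply: weight_span_root bx; rewrite /= cartan_dual_eval_coord.
    have [n hn] := nat_comb_coord Gamma_simple j nb.
    by rewrite -oppr_ge0 -linearN /= hn ler0n.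
  + apply: weight_span_root bx; rewrite /= cartan_dual_eval_coord.
    by move/negP: nj; rewrite negbK => /eqP ->.
- move=> x [b [[->|rb] /= b0 bx]]; apply: sub_lspan.
    by left; left; apply/(root_space0 H_cartan Gamma_simple).
  have [pb|nb] := Gpm b rb; last by left; right; exists b.
  right; exists b => //; split=> //; apply/negP; rewrite negbK.
  have [n hn] := nat_comb_coord Gamma_simple j pb.
  move: b0; rewrite cartan_dual_eval_coord hn lern0.
  by rewrite pnatr_eq0.
Qed.

Lemma parabolic_perpE :
  orth_in [set: g] (@killing _ g) (parabolic_minus Gamma j) = degree_le (-1).
Proof.
rewrite parabolicE; apply/seteqP; split=> [x [_ hx]|x x1].
  by rewrite -[-1]add0r -[0 in X in degree_le X]oppr0; apply: degree_le_perp.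
by split=> // y y0; apply: degree_le_orth x1 y0.
Qed.

Lemma laurent_poly_subspace (V : lmodType R[i]) : is_subspace (@laurent_poly V).
Proof.
split=> [|c f h [[N fN] [M fM]] [[N' hN] [M' hM]]]; first by split; exists 0.
split; [exists (Order.min N N') | exists (Order.max M M')] => n.
  rewrite lt_min => /andP[n1 n2].
  by rewrite -[LHS]/(c *: f n + h n) fN // hN // scaler0 addr0.
rewrite gt_max => /andP[n1 n2].
by rewrite -[LHS]/(c *: f n + h n) fM // hM // scaler0 addr0.
Qed.

Lemma lattice_subspace : is_subspace lattice.
Proof.
have sO := is_subspace_lspan; have sL := laurent_poly_subspace g.
split=> [|c f h [Of Lf] [Oh Lh]]; first by split; [exact: (proj1 (sO _ _ _)) | exact: (proj1 sL)].
by split; [exact: (proj2 (sO _ _ _)) | exact: (proj2 sL)].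
Qed.

Lemma O_order_monomial n x : degree_le (- n) x -> O_order hj (tensor (monomial R[i] n) x).
Proof.
move=> nx; have sO : is_subspace (O_order hj) := is_subspace_lspan _.
pose U := [set x | O_order hj (tensor (monomial R[i] n) x)].
apply: (@lspan_sub _ _ _ U _ _ _ nx) => [|{nx}x [b [wb bn bx]]].
  split=> [|c u v Uu Uv]; rewrite /U /=.
    have -> : tensor (monomial R[i] n) (0 : g) = 0 :> (int -> g).
      by apply/funext => i; rewrite /tensor scaler0.
    exact: subspace0.
  have -> : tensor (monomial R[i] n) (c *: u + v) =
      c *: tensor (monomial R[i] n) u + tensor (monomial R[i] n) v :> (int -> g).
    apply/funext => i; rewrite -[RHS]/(c *: tensor _ u i + tensor _ v i) /tensor.
    by rewrite scalerDr !scalerA mulrC.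
  exact: (proj2 sO).
apply: sub_lspan; case: wb bn bx => [->|rb] /= bn bx.
  left; move: bn; rewrite lfunE /= ler0z oppr_ge0 => n0.
  split=> [i|i i0]; rewrite tensor_monomialE; last first.
    by rewrite gt_eqF // (le_lt_trans n0).
  case: eqP => _; last exact: mem0v.
  exact/(root_space0 H_cartan Gamma_simple).
right; exists b, (monomial R[i] n), x; split=> //; split.
  by exists n => i; rewrite /monomial => /gt_eqF ->.
apply/ereal_infP => _ [m /= hm <-].
move: hm; rewrite /monomial pnatr_eq0 eqb0 negbK => /eqP mn.
rewrite lee_fin -lecR (rmorph_int (real_complex R)) (RRe_real ((proj1 hjP) b rb)).
by rewrite -(opprK m) mn.
Qed.

(** By [degree_le_full], [parabolicE], [parabolic_perpE] and [degree_le_eq0],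
    the condition is empty for [n < 0] and says [f 0 \in P], [f 1 \in Pperp] and
    [f n = 0] for [n > 1]. In this graded form the closure properties of the
    lattice follow from those of the filtration [degree_le]. *)
Lemma latticeP f : lattice f <-> laurent_poly f /\ forall n, degree_le (- n) (f n).
Proof.
split=> [[Of Lf]|[Lf df]].
  by split=> // n; apply: (O_order_degree H_cartan Gamma_simple hjP).
split=> //; apply: (laurent_poly_ind (is_subspace_lspan _) Lf) => n.
exact: O_order_monomial.
Qed.

Lemma lattice_monomial n x : degree_le (- n) x -> lattice (tensor (monomial R[i] n) x).
Proof. by move=> nx; split; [exact: O_order_monomial | exact: tensor_monomial_poly]. Qed.

(** The form pairs the coefficients [f i] and [h (1 - i)], of degrees at most
    [- i] and [i - 1]. *)
Lemma lattice_isotropic f h : lattice f -> lattice h -> conv (@killing _ g) f h 1 = 0.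
Proof.
move=> /latticeP[_ df] /latticeP[_ dh]; apply: conv0 => i.
by apply: degree_le_orth (df i) (dh (1 - i)); lia.
Qed.

(** Testing [f] against the terms [u ^ (1 - n) y] bounds the degree of [f n], by
    [degree_le_perp]. *)
Lemma lattice_coisotropic f : laurent f ->
  (forall h, lattice h -> conv (@killing _ g) f h 1 = 0) -> lattice f.
Proof.
move=> Lf fperp; have df n : degree_le (- n) (f n).
  have -> : - n = - (n - 1) - 1 by lia.
  apply: degree_le_perp => y yn.
  have := fperp (tensor (monomial R[i] (1 - n)) y).
  rewrite (@conv_single _ _ _ _ _ _ _ n) => [|i i_n].
    rewrite tensor_monomialE eqxx; apply; apply: lattice_monomial.
    by rewrite opprB.
  rewrite tensor_monomialE ifN ?killing0r //; apply: contra i_n => /eqP; lia.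
apply/latticeP; split=> //; split=> //; exists 1 => n n1.
by apply: degree_le_eq0 (df n); lia.
Qed.

Lemma lattice_lieb f h : lattice f -> lattice h -> lattice (conv lieb f h).
Proof.
move=> /latticeP[[[N fN] [M fM]] df] /latticeP[[[N' hN] [M' hM]] dh].
apply/latticeP; split=> [|n].
  split; [exists (N + N') | exists (M + M')] => n hn; apply: conv0 => i.
    have [iN|iN] := ltP i N; first by rewrite fN // lieb0l.
    by rewrite hN ?lieb0r //; lia.
  have [iM|iM] := ltP M i; first by rewrite fM // lieb0l.
  by rewrite hM ?lieb0r //; lia.
apply: conv_pred; first exact: subspace0.
  by move=> x y; apply: subspaceD.
move=> i; have -> : - n = - i + - (n - i) by lia.
exact: degree_le_lieb.
Qed.

Lemma laurent_split f : laurent f -> exists o p, [/\ lattice o, power_series p & f = o + p].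
Proof.
move=> [N fN]; exists (fun n => if n < 0 then f n else 0), (fun n => if n < 0 then 0 else f n).
split.
- apply/latticeP; split=> [|n].
    split; [exists N | exists 0] => n hn; first by rewrite fN // if_same.
    by rewrite ltNge (ltW hn).
  case: ifP => n0; last exact: subspace0.
  by apply: degree_le_full; lia.
- by move=> n /= ->.
apply/funext => n; rewrite -[RHS]/((if n < 0 then f n else 0) + (if n < 0 then 0 else f n)).
by case: ifP; rewrite ?addr0 ?add0r.
Qed.

Local Notation form := (ambient_form (monomial R[i] 0)).
Local Notation lagr := (lagrangian_subalgebra (@ambient_bracket _ g) (@ambient _ g) form).
Local Notation P := (parabolic_minus Gamma j).
Local Notation Pperp := (orth_in [set: g] (@killing _ g) P).
Local Notation fiber W := [set z : g * g | W (0 : int -> g, z)].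

Lemma killing_conv0l f n : conv (@killing _ g) 0 f n = 0.
Proof. by apply: conv0 => i; apply: killing0l. Qed.

Lemma lattice0 : lattice (0 : int -> g). Proof. exact: subspace0 lattice_subspace. Qed.

(** Being its own orthogonal, [W] contains the orthogonal of
    [lattice + g[eps]], hence the isotropic subspace [lattice]. *)
Lemma lagrangian_fiberE (W : set ((int -> g) * (g * g))) :
  is_subspace W -> W = orth_in (@ambient _ g) form W -> W `<=` lattice `*` setT ->
  W = lattice `*` fiber W.
Proof.
move=> sW WE WL; have LW f : lattice f -> W (f, 0).
  move=> Lf; rewrite WE; split; first by split=> //; case: Lf => _ [].
  move=> w /WL[Lw _]; rewrite ambient_formE /eps_form /= !killing0l addr0 subr0.
  exact: lattice_isotropic.
have e f z : (f, z) = (f, 0) + (0, z) :> (int -> g) * (g * g).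
  by rewrite -[RHS]/((f + 0, 0 + z)) addr0 add0r.
apply/seteqP; split=> [[f z] Wfz|[f z] [Lf /= Wz]].
  have [/= Lf _] := WL _ Wfz; split=> //=.
  by have := subspaceB sW Wfz (LW _ Lf); rewrite [in X in X -> _]e addrAC subrr add0r.
by rewrite e; apply: (subspaceD sW) => //; apply: LW.
Qed.

Lemma fiber_lagrangian (W : set ((int -> g) * (g * g))) : lagr W ->
  W = lattice `*` fiber W ->
  lagrangian_subalgebra (@eps_bracket _ g) [set: g * g] (@eps_form _ g) (fiber W).
Proof.
move=> [_ [sW bW] Wperp] WE; split=> //.
- split; first split=> [|c x y Wx Wy].
  + exact: (proj1 sW).
  + have := (proj2 sW) c _ _ Wx Wy.
    rewrite -[c *: (_, _) + _]/((c *: 0 + 0, c *: x + y)).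
    by rewrite scaler0 addr0.
  + move=> x y /= Wx Wy; have := bW _ _ Wx Wy; rewrite /ambient_bracket /=.
    suff -> : conv lieb (0 : int -> g) (0 : int -> g) = 0 by [].
    by apply/funext => n; apply: conv0 => i; apply: lieb0l.
apply/seteqP; split=> [z /= Wz|z [_ hz] /=].
  split=> // y /= Wy; move: Wz; rewrite {1}Wperp => -[_ /(_ _ Wy)].
  rewrite ambient_formE /= killing_conv0l sub0r => /eqP.
  by rewrite oppr_eq0 => /eqP.
rewrite Wperp; split; first by split=> //; exists 0.
move=> [f y]; rewrite {1}WE => -[_ /= Wy].
by rewrite ambient_formE /= killing_conv0l sub0r hz // oppr0.
Qed.

Lemma prod_lagrangian (L : set (g * g)) :
  lagrangian_subalgebra (@eps_bracket _ g) [set: g * g] (@eps_form _ g) L ->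
  lagr (lattice `*` L).
Proof.
move=> [_ [sL bL] Lperp]; split.
- by move=> [f z] [[_ []]].
- split; first split.
  + by split; [exact: lattice0 | exact: (proj1 sL)].
  + move=> c [f x] [h y] [/= Lf Lx] [/= Lh Ly].
    by split; [exact: (proj2 lattice_subspace) | exact: (proj2 sL)].
  + move=> [f x] [h y] [/= Lf Lx] [/= Lh Ly].
    by split; [exact: lattice_lieb | exact: bL].
apply/seteqP; split=> [[f x] [/= Lf Lx]|[f x] [[/= Lf _] fx]].
  split; first by split=> //; case: Lf => _ [].
  move=> [h y] [/= Lh Ly]; rewrite ambient_formE /= lattice_isotropic // sub0r.
  by move: Lx; rewrite Lperp => -[_ ->] //; rewrite oppr0.
split=> /=.
  apply: lattice_coisotropic => // h Lh.
  have := fx (h, 0) (conj Lh (proj1 sL)).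
  by rewrite ambient_formE /eps_form /= !killing0r addr0 subr0.
rewrite Lperp; split=> // y Ly.
have := fx (0, y) (conj lattice0 Ly); rewrite ambient_formE /=.
have -> : conv (@killing _ g) f 0 1 = 0 by apply: conv0 => i; apply: killing0r.
by rewrite sub0r => /eqP; rewrite oppr_eq0 => /eqP.
Qed.

Lemma lattice_coef01 p : lattice p -> P (p 0) /\ Pperp (p 1).
Proof.
move=> /latticeP[_ dp]; rewrite parabolic_perpE parabolicE.
by split; [have := dp 0; rewrite oppr0 | exact: dp].
Qed.

Lemma power_series_lattice x y : P x -> Pperp y ->
  exists p, [/\ lattice p, power_series p, p 0 = x & p 1 = y].
Proof.
rewrite parabolic_perpE parabolicE => x0 y1.
exists (tensor (monomial R[i] 0) x + tensor (monomial R[i] 1) y).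
have E n : (tensor (monomial R[i] 0) x + tensor (monomial R[i] 1) y) n =
  (if n == 0 then x else 0) + (if n == 1 then y else 0) by rewrite -!tensor_monomialE.
split; rewrite ?E ?addr0 ?add0r //.
  apply: (subspaceD lattice_subspace); exact: lattice_monomial.
by move=> n n0; rewrite [LHS]E lt_eqF // lt_eqF ?addr0 // (lt_trans n0).
Qed.

(** A Laurent series is a sum of a lattice element and a power series, and a
    power series in the lattice has its image in [P + eps Pperp], any element of
    which arises in this way. So modulo the lattice the power series are seen in
    [g[eps]] as [P + eps Pperp]. *)
Lemma prod_transversal (L : set (g * g)) : is_subspace L ->
  direct_sum (@ambient _ g) (lattice `*` L) (@embedded_power_series _ g) <->
  direct_sum [set: g * g] L (P `*` Pperp).
Proof.
move=> sL; split=> -[gen int0].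
  split.
    apply/seteqP; split=> // z _.
    have : @ambient _ g (0, z) by split=> //; exists 0.
    rewrite gen => -[[o l] [[q w] [[/= Lo Ll] [p pp [<- <-]] [oE zE]]]].
    exists l, (p 0, p 1); split=> //=.
    have Lp : lattice p.
      have -> : p = - o by apply/eqP; rewrite -addr_eq0 addrC -oE.
      exact: (subspaceN lattice_subspace).
    exact: lattice_coef01.
  apply/seteqP; split=> [[x y] [Lz [/= Px Py]]|_ ->]; last first.
    split; first exact: (proj1 sL).
    rewrite parabolic_perpE parabolicE.
    by split; exact: (proj1 (degree_sub _)).
  have [p [Lp pp p0 p1]] := power_series_lattice Px Py.
  have : ((lattice `*` L) `&` @embedded_power_series _ g) (p, (x, y)).
    by split=> //; exists p; rewrite // p0 p1.
  by rewrite int0 => -[_ -> ->].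
split.
  apply/seteqP; split=> [[f z] [/= Lf _]|_ [[o l] [[q w] [[/= [_ [Lo _]] _] [p pp [<- _]] ->]]]].
    have [o [p [Lo pp fE]]] := laurent_split Lf.
    have : [set: g * g] (z - (p 0, p 1)) by [].
    rewrite gen => -[l [[x y] [Ll [/= Px Py] zE]]].
    have [q [Lq qq q0 q1]] := power_series_lattice Px Py.
    exists (o - q, l), (p + q, ((p + q) 0, (p + q) 1)); split.
    - by split=> //=; apply: (subspaceB lattice_subspace).
    - exists (p + q) => //; move=> n n0.
      by rewrite -[LHS]/(p n + q n) pp // qq // addr0.
    rewrite -[RHS]/((o - q) + (p + q), l + (p 0 + q 0, p 1 + q 1)); congr (_, _).
      by rewrite fE addrACA addNr addr0.
    rewrite q0 q1 -[(p 0 + x, _)]/((p 0, p 1) + (x, y)) addrCA -zE.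
    by rewrite addrC subrK.
  split=> //=; case: Lo => N oN; exists (Order.min N 0) => n.
  rewrite lt_min => /andP[nN n0].
  by rewrite -[LHS]/(o n + p n) oN // pp // addr0.
apply/seteqP; split=> [[f z] [[/= Lf Lz] [p pp [pf pz]]]|_ ->]; last first.
  split; first by split; [exact: lattice0 | exact: (proj1 sL)].
  by exists 0.
have Lp : lattice p by rewrite pf.
have [P0 P1] := lattice_coef01 Lp.
have : (L `&` (P `*` Pperp)) (p 0, p 1) by split; rewrite // pz.
rewrite int0 => -[p0 p1].
have p00 : p = 0.
  apply/funext => n; have [n0|n0] := ltP n 0; first exact: pp.
  have [->|n0'] := eqVneq n 0; first exact: p0.
  have [->|n1] := eqVneq n 1; first exact: p1.
  have /latticeP[_ /(_ n)] := Lp; apply: degree_le_eq0; lia.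
by rewrite -pf -pz p00.
Qed.

End CoefficientOne.

(** * The degenerate case *)

(** For the zero form a Lagrangian is the whole ambient space, which is not
    transversal to a nonzero subspace. *)
Lemma killing0_no_lagrangian_in_order (K : fieldType) (g : lieType K)
    (W : set ((int -> g) * (g * g))) :
  simple_lie g -> (forall x y : g, killing x y = 0) ->
  W = orth_in (@ambient _ g) (ambient_form (monomial K 0)) W ->
  direct_sum (@ambient _ g) W (@embedded_power_series _ g) -> False.
Proof.
move=> [[x [y xy0]] _] K0 WE [_ int0].
have x0 : x != 0 by apply: contra_neq xy0 => ->; rewrite lieb0l.
pose f : int -> g := tensor (monomial K 0) x.
have fE n : f n = if n == 0 then x else 0 := tensor_monomialE 0 x n.
have : (W `&` @embedded_power_series _ g) (f, (f 0, f 1)).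
  split; last by exists f => // n n0; rewrite fE lt_eqF.
  rewrite WE; split; first by split=> //; case: (tensor_monomial_poly 0 x).
  move=> w _; rewrite ambient_formE /eps_form !K0 addr0 subr0.
  by apply: conv0 => i; apply: K0.
rewrite int0 => -[_ f0 _]; move: f0; rewrite fE eqxx => f0.
by rewrite f0 eqxx in x0.
Qed.

(** Again the Lagrangian is everything, while [eps Pperp] is [eps g]. *)
Lemma killing0_no_lagrangian_eps (K : fieldType) (g : lieType K) (P : set g)
    (L : set (g * g)) :
  simple_lie g -> (forall x y : g, killing x y = 0) -> P 0 ->
  L = orth_in [set: g * g] (@eps_form _ g) L ->
  direct_sum [set: g * g] L (P `*` orth_in [set: g] (@killing _ g) P) -> False.
Proof.
move=> [[x [y xy0]] _] K0 P0 LE [_ int0].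
have x0 : x != 0 by apply: contra_neq xy0 => ->; rewrite lieb0l.
have : (L `&` (P `*` orth_in [set: g] (@killing _ g) P)) (0, x).
  split; first by rewrite LE; split=> // w _; rewrite /eps_form !K0 addr0.
  by split=> //; split=> // w _; apply: K0.
by rewrite int0 => -[xx0]; rewrite xx0 eqxx in x0.
Qed.

(** * The correspondence of Lagrangian subalgebras *)

Theorem theorem4p3 (R : realType) (g : lieType R[i]) (g_simple : simple_lie g)
  (H : {vspace g}) (H_cartan : cartan_subalgebra H)
  (r : nat) (Gamma : r.-tuple (cartan_dual H)) (Gamma_simple : simple_roots Gamma)
  (amax : cartan_dual H) (amax_maximal : maximal_root Gamma amax)
  (j : 'I_r) (hj : subvs_of H) (hjP : order_point Gamma amax j hj)
  (a : int -> R[i]) (a_eq1 : a = monomial R[i] 0) :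
  let k : R[i] := coord Gamma j amax in
  let P := parabolic_minus Gamma j in
  let Pperp := orth_in [set: g] (@killing _ g) P in
  let lagrangians_in_order : set (set ((int -> g) * (g * g))) :=
    [set W | [/\ lagrangian_subalgebra (@ambient_bracket _ g) (@ambient _ g)
                   (ambient_form a) W,
                 direct_sum (@ambient _ g) W (@embedded_power_series _ g)
               & W `<=` (O_order hj `&` @laurent_poly g) `*` [set: g * g]]] in
  let lagrangians_eps : set (set (g * g)) :=
    [set W | lagrangian_subalgebra (@eps_bracket _ g) [set: g * g]
               (@eps_form _ g) W
             /\ direct_sum [set: g * g] W (P `*` Pperp)] in
  (k = 1 ->
     exists F : set ((int -> g) * (g * g)) -> set (g * g),
       set_bij lagrangians_in_order lagrangians_eps F)
  /\ (1 < k -> lagrangians_in_order = set0).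
Proof.
move=> k P Pperp lagrangians_in_order lagrangians_eps; subst a.
have [K0|nondeg] := killing0_or_nondeg g_simple.
  have order0 : lagrangians_in_order = set0.
    apply/seteqP; split=> // W [[_ _ WE] Wsum _].
    exact: killing0_no_lagrangian_in_order WE Wsum.
  split=> // _; exists (fun=> set0); split.
  - by move=> W; rewrite order0.
  - by move=> W W'; rewrite order0 inE.
  - move=> L [[_ _ LE] Lsum]; exfalso.
    apply: killing0_no_lagrangian_eps K0 _ LE Lsum => //.
    exact: subspace0 (is_subspace_lspan _).
split=> [k1|k1]; last first.
  apply/seteqP; split=> // W [[_ _ WE] _ WO].
  exact: (no_lagrangian_in_order H_cartan Gamma_simple hjP nondeg k1 WE WO).
pose lattice := O_order hj `&` @laurent_poly g.
pose F (W : set ((int -> g) * (g * g))) := [set z | W (0, z)].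
have FE W : lagrangians_in_order W -> W = lattice `*` F W.
  move=> [[_ [sW _] WE] _ WO].
  exact: (lagrangian_fiberE H_cartan Gamma_simple hjP sW WE WO).
have FL L : F (lattice `*` L) = L.
  apply/seteqP; split=> [z [_ Lz] //|z Lz]; split=> //.
  exact: (lattice0 hj).
exists F; split.
- move=> W lW; have WE := FE W lW; have [lagW sumW _] := lW.
  have lagF := fiber_lagrangian lagW WE.
  split=> //; have [_ [sF _] _] := lagF.
  apply/(prod_transversal H_cartan Gamma_simple hjP amax_maximal nondeg k1 sF).
  by rewrite -[_ `*` _]WE.
- by move=> W W'; rewrite !inE => /FE {2}-> /FE {2}-> ->.
- move=> L [lagL sumL]; exists (lattice `*` L); last exact: FL.
  have [_ [sL _] _] := lagL; split.
  + exact: (prod_lagrangian H_cartan Gamma_simple hjP amax_maximal nondeg k1).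
  + exact/(prod_transversal H_cartan Gamma_simple hjP amax_maximal nondeg k1 sL).
  + by move=> z [].
Qed.
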